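(* Let $\alpha,\beta,\gamma,\kappa>0$ be real and assume $\Delta:=1+\alpha-\kappa>0$, so that the power series $$E_{\alpha,\beta}^{\gamma,\kappa}(z)=\sum_{n=0}^{\infty}\frac{\Gamma(\gamma+\kappa n)}{\Gamma(\gamma)\,n!\,\Gamma(\beta+\alpha n)}\,z^n$$ defines an entire function. Then the function $x\mapsto E_{\alpha,\beta}^{\gamma,\kappa}(-x)$ is completely monotone on $(0,\infty)$ if and only if $\alpha\leq\kappa$ and $\kappa\beta\geq\alpha\gamma$.
   Context: A smooth function $f:(0,\infty)\to\mathbb{R}$ is completely monotone on $(0,\infty)$ if $(-1)^n f^{(n)}(x)\geq 0$ for every integer $n\geq 0$ and every $x>0$ (continuity at zero is not part of the definition). When $1+\alpha-\kappa>0$ the displayed series has infinite radius of convergence. *)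

(* Defs.v *)
From HB Require Import structures.
From mathcomp Require Import all_boot all_order all_algebra.
From mathcomp Require Import all_classical all_reals all_analysis.

Set Implicit Arguments.
Unset Strict Implicit.
Unset Printing Implicit Defensive.
Import Order.TTheory GRing.Theory Num.Theory.
Import numFieldNormedType.Exports.

Local Open Scope classical_set_scope.
Local Open Scope ring_scope.

(* Euler's integral of the second kind; meaningful for [0 < s], where the
   integral is finite (otherwise [Rintegral] returns a default value). *)
Definition Gamma {R : realType} (s : R) : R :=
  \int[lebesgue_measure]_(t in `]0, +oo[) (t `^ (s - 1) * expR (- t)).

Definition ML_coef {R : realType} (alpha beta gamma kappa : R) (n : nat) : R :=
  Gamma (gamma + kappa * n%:R) /
    (Gamma gamma * n`!%:R * Gamma (beta + alpha * n%:R)).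

(* The generalized Mittag-Leffler function E_{alpha,beta}^{gamma,kappa} on the
   real line; the limit exists for every [z] when [0 < 1 + alpha - kappa]. *)
Definition ML {R : realType} (alpha beta gamma kappa : R) (z : R) : R :=
  limn (pseries (ML_coef alpha beta gamma kappa) z).

(* Only the values of [f] on the open half-line matter: the iterated
   derivatives at [0 < x] are local. *)
Definition smooth_on_pos {R : realType} (f : R -> R) : Prop :=
  forall (n : nat) (x : R), 0 < x -> derivable f^`(n)%classic x 1.

Definition completely_monotone {R : realType} (f : R -> R) : Prop :=
  smooth_on_pos f /\
  forall (n : nat) (x : R), 0 < x -> 0 <= (-1) ^+ n * f^`(n)%classic x.

(* Main.v *)
Require Import Defs.
From mathcomp Require Import all_boot all_order all_algebra.
From mathcomp Require Import all_classical all_reals all_analysis.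
From mathcomp Require Import measurable_realfun.
From mathcomp Require Import ring lra.
Set Implicit Arguments.
Unset Strict Implicit.
Unset Printing Implicit Defensive.
Import Order.TTheory GRing.Theory Num.Theory.
Import numFieldNormedType.Exports.
Local Open Scope ring_scope.
Local Open Scope classical_set_scope.

(** Up to the factor [1 / Gamma gamma] the function at hand is
    [F x = \sum_n m_n (- x)^n / n!] with
    [m_n = Gamma (gamma + kappa n) / Gamma (beta + alpha n)], and [- F'] is the
    same series with [(beta, gamma)] replaced by
    [(beta + alpha, gamma + kappa)]. Complete monotonicity therefore says that
    all the functions obtained by iterating this shift are nonnegative on the
    half-line ([completely_monotone_ML_egf]).

    Sufficiency. Gauss's product gives
    [m_n = lim_N N^(gamma - beta + (kappa - alpha) n)
           \prod_(i < N) (beta + alpha n + i) / (gamma + kappa n + i)]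
    ([Gamma_quot_cvg]). The [i]-th factor is a positive constant times
    [(n + b) / (n + a)] with [b = (beta + i) / alpha] and
    [a = (gamma + i) / kappa]; the conditions [alpha <= kappa] and
    [alpha gamma <= kappa beta] make [a <= b] for every [i]. Multiplying the
    coefficients of a series [g] by [(n + b) / (n + a)] replaces [g] by
    [g + (b - a) h], where [x h' + a h = g]; as [(x^a h)' = x^(a - 1) g], the
    sign of [g] passes to [h] ([euler_ode_decay]). So one starts from
    [exp (- c x)] and multiplies the factors in. This is carried out on the
    truncated series, where letting [N] tend to infinity is a limit of finitely
    many coefficients, and where [exp (- x)] is below the sums with an odd
    number of terms and above the sums with an even number of terms
    ([truncated_bound], [ML_egf_ge0]). The same induction with a weight [x^p]
    shows that [F] is [O(x^-p)] for all [p < gamma / kappa] ([ML_egf_decay]).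

    Necessity of [alpha <= kappa]. The Taylor coefficients of a completely
    monotone function with an everywhere convergent Taylor series are, up to
    sign, moments of a positive measure, hence log-convex
    ([alternating_derivatives_log_convex]); so [m_(n+1) / m_n] is
    nondecreasing. But this quotient has order [n^(kappa - alpha)]
    ([ML_moment_ratio]).

    Necessity of [alpha gamma <= kappa beta], when [alpha <= kappa]. Write
    [F_j] for [F] with [beta + j] instead of [beta]. Then
    [alpha x F_(j+1)' + (beta + j) F_(j+1) = F_j], so that nonnegativity and
    monotonicity pass from [F_j] to [F_(j+1)], and
    [F_j <= (beta + j) F_(j+1)]. Since [F_J] satisfies the two conditions for
    large [J], [F_1] inherits its decay [O(x^-p)]. If
    [beta / alpha < gamma / kappa], some [p] lies strictly in between, and
    [x^(beta / alpha) F_1] tends to [0]; yet this function is nondecreasing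
    because [F_0] is nonnegative, and positive near [0] ([ML_necessary_pole]).
    In terms of Mellin transforms: the first zero of
    [Gamma (gamma + kappa s) / Gamma (beta + alpha s)] to the left of [0] cannot
    come before its first pole. *)

(** * Integrals over the open half-line *)

Lemma derive_continuous (R : realType) (f : R -> R) (df x : R) :
  is_derive x 1 f df -> {for x, continuous f}.
Proof. by case=> fx _; exact/differentiable_continuous/derivable1_diffP. Qed.

(** The integrand may blow up at [0], so the half-line is exhausted by the
    closed half-lines starting at [1 / (n + 1)]. *)
Lemma ge0_FTC_halfline (R : realType) (f F : R -> R) (l0 l : R) :
  (forall x, 0 < x -> 0 <= f x) ->
  (forall x, 0 < x -> {for x, continuous f}) ->
  (forall x : R, 0 < x -> is_derive x 1 F (f x)) ->
  F x @[x --> 0^'+] --> l0 -> F x @[x --> +oo] --> l ->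
  (\int[lebesgue_measure]_(x in `]0%R, +oo[) (f x)%:E = (l - l0)%:E)%E.
Proof.
move=> f0 cf dF F0 Fl.
pose D n : set R := `[n.+1%:R^-1, +oo[%classic.
have n0 n : 0 < n.+1%:R^-1 :> R by rewrite invr_gt0.
have le0 n (x : R) : n.+1%:R^-1 <= x -> 0 < x by exact: lt_le_trans.
have lt0 n (x : R) : n.+1%:R^-1 < x -> 0 < x by move/ltW; exact: le0.
have cfD n : {within D n, continuous f}.
  apply/continuous_within_itvcyP; split.
    by move=> x; rewrite in_itv/= andbT => /lt0; exact: cf.
  exact/cvg_at_right_filter/cf.
have ID n : (\int[lebesgue_measure]_(x in D n) (f x)%:E
    = l%:E - (F n.+1%:R^-1)%:E)%E.
  apply: ge0_continuous_FTC2y => //.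
  - by move=> x xn; exact/f0/(le0 n).
  - exact: cfD.
  - by move=> x xn; case: (dF x (lt0 _ _ xn)).
  - by apply/cvg_at_right_filter; exact: derive_continuous (dF _ (n0 n)).
  - move=> x; rewrite in_itv/= andbT => xn.
    by case: (dF x (lt0 _ _ xn)) => _ <-; rewrite derive1E.
have DU : `]0%R, +oo[%classic = \bigcup_n D n.
  apply/seteqP; split=> x /=.
    rewrite in_itv/= andbT => x0; exists (Num.truncn x^-1) => //.
    rewrite /D /= in_itv/= andbT -[leRHS]invrK lef_pV2 ?posrE ?invr_gt0//.
    by rewrite ltW// truncnS_gt.
  by move=> [n _]; rewrite /D /= !in_itv/= !andbT; exact: le0.
have cI : (\int[lebesgue_measure]_(x in D n) (f x)%:E @[n --> \oo] -->
    \int[lebesgue_measure]_(x in `]0%R, +oo[) (f x)%:E)%E.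
  rewrite DU; apply: ge0_nondecreasing_set_cvg_integral.
  - apply/nondecreasing_seqP => n; apply/subsetPset => x.
    rewrite /D /= !in_itv/= !andbT; apply: le_trans.
    by rewrite lef_pV2 ?posrE// ler_nat.
  - by move=> n; exact: measurable_itv.
  - move=> n; apply/measurable_EFinP.
    apply: subspace_continuous_measurable_fun; last exact: cfD.
    exact: measurable_itv.
  - move=> n x; rewrite /D /= in_itv/= andbT lee_fin => /le0.
    exact: f0.
have cL : (\int[lebesgue_measure]_(x in D n) (f x)%:E @[n --> \oo] -->
    (l - l0)%:E)%E.
  under eq_fun do rewrite ID -EFinB.
  apply: cvg_EFin; first exact: nearW.
  apply: cvgB; first exact: cvg_cst.
  have /cvg_at_rightP := F0.
  apply; split; first by move=> n; exact: n0.
  exact: cvg_harmonic.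
by apply: cvg_unique cI cL.
Qed.

Lemma measurable_halfline (R : realType) (f : R -> R) :
  (forall x, 0 < x -> {for x, continuous f}) ->
  measurable_fun (`]0, +oo[ : set R) f.
Proof.
move=> cf; apply: open_continuous_measurable_fun => // x.
by rewrite inE/= in_itv/= andbT; exact: cf.
Qed.

Lemma integrable_halfline_FTC (R : realType) (f F : R -> R) (l0 l : R) :
  (forall x, 0 < x -> 0 <= f x) ->
  (forall x, 0 < x -> {for x, continuous f}) ->
  (forall x : R, 0 < x -> is_derive x 1 F (f x)) ->
  F x @[x --> 0^'+] --> l0 -> F x @[x --> +oo] --> l ->
  lebesgue_measure.-integrable (`]0, +oo[ : set R) (EFin \o f) /\
  \int[lebesgue_measure]_(x in `]0, +oo[) f x = l - l0.
Proof.
move=> f0 cf dF F0 Fl.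
have I := ge0_FTC_halfline f0 cf dF F0 Fl.
split; last by rewrite /Rintegral I.
apply/integrableP; split.
  by apply/measurable_EFinP; exact: measurable_halfline.
under eq_integral.
  move=> x; rewrite inE/= in_itv/= andbT => x0.
  rewrite ger0_norm ?f0//; over.
by rewrite /= I ltry.
Qed.

(** * Euler's integral: finiteness, recurrence, growth *)

Lemma ln_le_subr1 (R : realType) (x : R) : 0 < x -> ln x <= x - 1.
Proof.
move=> x0; rewrite -[x in ln x](subrKC 1); apply: le_ln1Dx.
by rewrite ltrBrDl subrr.
Qed.

(** The maximum of [x^p exp (- x)] is attained at [x = p]; the factor
    [exp (- p)] of its value is dropped. *)
Lemma powR_expR_le (R : realType) (p x : R) :
  0 < p -> 0 < x -> x `^ p * expR (- x) <= p `^ p.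
Proof.
move=> p0 x0.
rewrite /powR !gt_eqF// -expRD ler_expR.
have : ln (x / p) <= x / p - 1 by apply: ln_le_subr1; rewrite divr_gt0.
rewrite ln_div ?posrE// => /(ler_wpM2l (ltW p0)).
rewrite !mulrBr mulr1 mulrCA mulfV ?gt_eqF// mulr1.
by lra.
Qed.

Lemma powR_continuous (R : realType) (p x : R) : 0 < x ->
  {for x, continuous (fun t : R => t `^ p)}.
Proof. by move=> x0; apply: derive_continuous (is_derive1_powR p x0). Qed.

Lemma gamma_integrand_continuous (R : realType) (p x : R) : 0 < x ->
  {for x, continuous (fun t : R => t `^ p * expR (- t))}.
Proof.
move=> x0; apply: continuousM; first exact: powR_continuous.
apply: continuous_comp; first exact: opp_continuous.
exact: continuous_expR.
Qed.

(** Integrating the derivative of [t^s exp (- t)] over the half-line gives the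
    recurrence, but that derivative changes sign. Adding
    [c exp (- t / 2) >= t^s exp (- t)] makes it nonnegative, and then its
    integral exists and is given by the boundary values; subtracting the added
    terms yields both the integrability of [t^(s - 1) exp (- t)], for all
    [0 < s] at once, and the value of its integral. *)
Lemma Gamma_integrable_rec (R : realType) (s : R) : 0 < s ->
  lebesgue_measure.-integrable (`]0, +oo[ : set R)
    (EFin \o (fun t : R => t `^ (s - 1) * expR (- t))) /\
  Gamma (s + 1) = s * Gamma s.
Proof.
move=> s0.
(* [c exp (- t / 2)] dominates [t^s exp (- t)], by the bound on
   [(t / 2)^s exp (- t / 2)]. *)
pose c : R := 2 `^ s * s `^ s.
have c0 : 0 < c by rewrite mulr_gt0// powR_gt0.
have boundc x : 0 < x -> x `^ s * expR (- x) <= c * expR (- (x / 2)).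
  move=> x0; have x20 : 0 < x / 2 by rewrite divr_gt0.
  have h := powR_expR_le s0 x20.
  rewrite [- x](_ : _ = - (x / 2) + - (x / 2)); last by lra.
  have -> : x `^ s = 2 `^ s * (x / 2) `^ s.
    by rewrite -powRM ?(ltW x20)//; congr powR; lra.
  rewrite expRD.
  rewrite -mulrA [X in _ * X]mulrA mulrA ler_wpM2r ?expR_ge0//.
  by rewrite ler_wpM2l// powR_ge0.
pose E x : R := c * expR (- (x / 2)).
pose A x : R := s * (x `^ (s - 1) * expR (- x)) - x `^ s * expR (- x) + E x.
have dE (x : R) : is_derive x 1 (fun x => - 2 * E x) (E x).
  rewrite /E; apply: is_derive_eq.
  by rewrite !scaler0 /GRing.scale/=; field.
have cE x : {for x, continuous E}.
  apply: continuousM; first exact: cst_continuous.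
  apply: continuous_comp; last exact: continuous_expR.
  apply: continuous_comp; last exact: opp_continuous.
  by apply: continuousM; [exact: cvg_id|exact: cst_continuous].
have E0 : - 2 * E x @[x --> 0^'+] --> - 2 * c.
  have -> : - 2 * c = - 2 * E 0 by rewrite /E mul0r oppr0 expR0 mulr1.
  apply/cvg_at_right_filter; apply: cvgMl_tmp; exact: cE.
have Ey : E x @[x --> +oo] --> 0.
  rewrite -(mulr0 c); apply: cvgMl_tmp.
  apply: (@cvg_comp _ _ _ (fun x : R => x / 2) (fun z : R => expR (- z)) _
    (pinfty_nbhs R)); last exact: cvgr_expR.
  by apply: gt0_cvgMly; [rewrite invr_gt0|exact: cvg_id].
have Ey' : - 2 * E x @[x --> +oo] --> 0.
  by rewrite -(mulr0 (- 2)); exact: cvgMl_tmp.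
have [iE IE] : lebesgue_measure.-integrable (`]0, +oo[ : set R) (EFin \o E) /\
    \int[lebesgue_measure]_(x in `]0, +oo[) E x = 0 - - 2 * c.
  apply: integrable_halfline_FTC E0 Ey' => // x _.
  by rewrite mulr_ge0 ?expR_ge0// ltW.
have [iA IA] : lebesgue_measure.-integrable (`]0, +oo[ : set R) (EFin \o A) /\
    \int[lebesgue_measure]_(x in `]0, +oo[) A x = 0 - - 2 * c.
  pose F x : R := x `^ s * expR (- x) + - 2 * E x.
  apply: (@integrable_halfline_FTC _ _ F).
  - move=> x x0; rewrite /A; have := boundc _ x0; rewrite -/(E x) => h.
    have : 0 <= s * (x `^ (s - 1) * expR (- x)).
      by rewrite !mulr_ge0 ?powR_ge0 ?expR_ge0// ltW.
    by lra.
  - move=> x x0; apply: continuousD; last exact: cE.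
    apply: continuousB; last exact: gamma_integrand_continuous.
    apply: continuousM; first exact: cst_continuous.
    exact: gamma_integrand_continuous.
  - move=> x x0; rewrite /F.
    have dp := is_derive1_powR s x0.
    apply: is_derive_eq.
    by rewrite /A /GRing.scale/=; lra.
  - rewrite -[X in _ --> X]add0r; apply: cvgD E0.
    have e0 : expR (- x) @[x --> (0 : R)^'+] --> expR (- (0 : R)).
      apply/cvg_at_right_filter; apply: continuous_comp.
        exact: opp_continuous.
      exact: continuous_expR.
    have := cvgM (powR_cvg0 s0) e0; rewrite mul0r; apply.
  - rewrite -[X in _ --> X]add0r; apply: cvgD Ey'.
    apply: (squeeze_cvgr _ _ Ey); last exact: cvg_cst.
    near=> x; have x0 : 0 < x by near: x; exact: nbhs_pinfty_gt.
    by rewrite boundc// andbT mulr_ge0 ?powR_ge0 ?expR_ge0.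
pose B x : R := x `^ s * expR (- x).
have mD : measurable (`]0, +oo[ : set R) by exact: measurable_itv.
have iB : lebesgue_measure.-integrable (`]0, +oo[ : set R) (EFin \o B).
  apply: le_integrable iE => //.
    apply/measurable_EFinP; apply: measurable_halfline => x x0.
    exact: gamma_integrand_continuous.
  move=> x /=; rewrite in_itv/= andbT lee_fin => x0.
  rewrite !ger0_norm ?boundc// mulr_ge0 ?powR_ge0 ?expR_ge0//.
  exact: ltW.
have AE x : s * (x `^ (s - 1) * expR (- x)) = A x + (B x - E x).
  by rewrite /A /B; lra.
have iBE : lebesgue_measure.-integrable (`]0, +oo[ : set R)
    (EFin \o (fun x => B x - E x)).
  have : lebesgue_measure.-integrable (`]0, +oo[ : set R)
      ((EFin \o B) \- (EFin \o E))%E by exact: integrableB.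
  exact: eq_integrable.
have iG : lebesgue_measure.-integrable (`]0, +oo[ : set R)
    (EFin \o (fun t : R => t `^ (s - 1) * expR (- t))).
  have iABE : lebesgue_measure.-integrable (`]0, +oo[ : set R)
      ((EFin \o A) \+ (EFin \o (fun x => B x - E x)%R))%E by exact: integrableD.
  have : lebesgue_measure.-integrable (`]0, +oo[ : set R)
      (fun x => s^-1%:E * ((EFin \o A) \+ (EFin \o (fun x => B x - E x)%R)) x)%E.
    exact: integrableZl.
  apply: eq_integrable => // x _.
  have AE' : s^-1 * (A x + (B x - E x)) = x `^ (s - 1) * expR (- x).
    by rewrite -AE mulKf ?gt_eqF.
  by rewrite [RHS]/= -AE' EFinM.
split=> //.
rewrite /Gamma addrK -RintegralZl//.
under [RHS]eq_Rintegral do rewrite AE.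
rewrite RintegralD// RintegralB// IA IE.
by rewrite addrCA subrr addr0.
Unshelve. all: by end_near. Qed.

Lemma GammaD1 (R : realType) (s : R) : 0 < s -> Gamma (s + 1) = s * Gamma s.
Proof. by case/Gamma_integrable_rec. Qed.

(** The integral is at least the one over [[1, 2]], where [0 <= ln t <= 1]
    bounds the integrand below by a positive constant. *)
Lemma Gamma_gt0 (R : realType) (s : R) : 0 < s -> 0 < Gamma s.
Proof.
move=> s0; have [iG _] := Gamma_integrable_rec s0.
have mD : measurable (`]0, +oo[ : set R) by exact: measurable_itv.
pose c : R := expR (- `|s - 1| - 2).
suff : (c%:E <= \int[lebesgue_measure]_(x in (`]0%R, +oo[ : set R))
    (x `^ (s - 1) * expR (- x))%:E)%E.
  have fI : (\int[lebesgue_measure]_(x in (`]0%R, +oo[ : set R))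
    (x `^ (s - 1) * expR (- x))%:E)%E \is a fin_num by exact: integrable_fin_num.
  rewrite -[leRHS]fineK// lee_fin => /(lt_le_trans _); apply.
  exact: expR_gt0.
have mI : measurable (`[1, 2] : set R) by exact: measurable_itv.
have sub : (`[1, 2] : set R) `<=` (`]0%R, +oo[ : set R).
  by move=> x /=; rewrite !in_itv/= andbT => /andP[+ _]; exact: lt_le_trans.
have mf : measurable_fun (`]0, +oo[ : set R)
    (EFin \o (fun x : R => x `^ (s - 1) * expR (- x))).
  by case/integrableP: iG.
have pos x : (0 <= (x `^ (s - 1) * expR (- x))%:E)%E.
  by rewrite lee_fin mulr_ge0 ?powR_ge0 ?expR_ge0.
apply: (@le_trans _ _ (\int[lebesgue_measure]_(x in (`[1%R, 2%R] : set R))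
    (x `^ (s - 1) * expR (- x))%:E)%E); last exact: ge0_subset_integral.
have -> : c%:E = (\int[lebesgue_measure]_(x in (`[1%R, 2%R] : set R)) c%:E)%E.
  rewrite integral_cst//= lebesgue_measure_itv/= lte_fin ltr1n/=.
  by rewrite -EFinM; congr EFin; lra.
apply: ge0_le_integral => //.
- by move=> x _; rewrite lee_fin expR_ge0.
- exact: measurable_funS mf.
move=> x /=; rewrite in_itv/= => /andP[x1 x2].
have x0 : 0 < x by exact: lt_le_trans x1.
rewrite lee_fin /powR gt_eqF// -expRD ler_expR.
have l0 : 0 <= ln x by exact: ln_ge0.
have l1 : ln x <= 1 by rewrite (le_trans (ln_le_subr1 x0)) ?lerBlDr.
have : `|(s - 1) * ln x| <= `|s - 1|.
  by rewrite normrM (ger0_norm l0) ler_piMr.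
rewrite ler_norml => /andP[+ _].
by lra.
Qed.

(** The convex function [v^(- k)] lies above its tangent at [1]; the growth
    estimates for Gamma come from this inequality by integration. *)
Lemma powRN_tangent (R : realType) (k v : R) : 0 <= k -> 0 < v ->
  1 - k * (v - 1) <= v `^ (- k).
Proof.
move=> k0 v0; rewrite /powR gt_eqF//.
apply: le_trans (expR_ge1Dx _).
by rewrite mulNr lerD2l lerN2 ler_wpM2l// ln_le_subr1.
Qed.

Lemma Gamma_comb_le (R : realType) (u v w a b c : R) :
  0 < u -> 0 < v -> 0 < w ->
  (forall t, 0 < t ->
     b * t `^ (v - 1) - c * t `^ (w - 1) <= a * t `^ (u - 1)) ->
  b * Gamma v - c * Gamma w <= a * Gamma u.
Proof.
move=> u0 v0 w0 h.
have [iu _] := Gamma_integrable_rec u0.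
have [iv _] := Gamma_integrable_rec v0.
have [iw _] := Gamma_integrable_rec w0.
have mD : measurable (`]0, +oo[ : set R) by exact: measurable_itv.
have iZ (d : R) (f : R -> R) :
    lebesgue_measure.-integrable (`]0, +oo[ : set R) (EFin \o f) ->
    lebesgue_measure.-integrable (`]0, +oo[ : set R) (EFin \o (fun x => d * f x)).
  move=> fi; have : lebesgue_measure.-integrable (`]0, +oo[ : set R)
      (fun x => d%:E * (EFin \o f) x)%E by exact: integrableZl.
  exact: eq_integrable.
have iB (f g : R -> R) :
    lebesgue_measure.-integrable (`]0, +oo[ : set R) (EFin \o f) ->
    lebesgue_measure.-integrable (`]0, +oo[ : set R) (EFin \o g) ->
    lebesgue_measure.-integrable (`]0, +oo[ : set R)
      (EFin \o (fun x => f x - g x)).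
  move=> fi gi; have : lebesgue_measure.-integrable (`]0, +oo[ : set R)
      ((EFin \o f) \- (EFin \o g))%E by exact: integrableB.
  exact: eq_integrable.
rewrite /Gamma -!RintegralZl// -RintegralB//; [|exact: iZ..].
apply: le_Rintegral => //.
- by apply: iB; exact: iZ.
- exact: iZ.
move=> x /=; rewrite in_itv/= andbT => x0.
by rewrite !mulrA -mulrBl ler_wpM2r ?expR_ge0// h.
Qed.

(** Jensen's inequality for [v^(- k)] and the probability density
    proportional to [t^(s + k - 1) exp (- t)], whose mean is [s + k]. *)
Lemma Gamma_ratio_le (R : realType) (s k : R) : 0 < s -> 0 <= k ->
  Gamma (s + k) <= (s + k) `^ k * Gamma s.
Proof.
move=> s0 k0; set c := s + k.
have c0 : 0 < c by rewrite ltr_pwDl.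
have : (1 + k) * Gamma c - k / c * Gamma (c + 1) <= c `^ k * Gamma s.
  apply: Gamma_comb_le => //; first by rewrite addr_gt0.
  move=> t t0.
  have tc0 : 0 < t / c by rewrite divr_gt0.
  have h := powRN_tangent k0 tc0.
  have -> : c `^ k * t `^ (s - 1) = t `^ (c - 1) * (t / c) `^ (- k).
    rewrite powRM ?ltW ?invr_gt0// mulrA -powRD; last first.
      by rewrite (gt_eqF t0) implybT.
    rewrite -powR_inv1 ?ltW// -powRrM mulN1r opprK mulrC.
    by congr (_ `^ _ * _); rewrite /c; lra.
  have -> : t `^ (c + 1 - 1) = t `^ (c - 1) * t.
    rewrite addrK -[in LHS](subrK 1 c) (@powRD _ t (c - 1) 1).
      by rewrite powRr1// ltW.
    by rewrite (gt_eqF t0) implybT.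
  have := ler_wpM2l (powR_ge0 t (c - 1)) h.
  apply: le_trans.
  by rewrite le_eqVlt; apply/orP; left; apply/eqP; field; rewrite gt_eqF.
rewrite GammaD1// mulrA mulfVK ?gt_eqF//.
by rewrite mulrDl mul1r addrK.
Qed.

(** Jensen's inequality for [v^(- k)] with [v = (s - 1) / t] and the density
    proportional to [t^(s - 1) exp (- t)], for which [1 / t] has mean
    [1 / (s - 1)]. *)
Lemma Gamma_ratio_ge (R : realType) (s k : R) : 1 < s -> 0 <= k ->
  (s - 1) `^ k * Gamma s <= Gamma (s + k).
Proof.
move=> s1 k0; have s0 : 0 < s by rewrite (lt_trans _ s1).
have r0 : 0 < s - 1 by rewrite subr_gt0.
have sE : s - 1 + 1 = s by rewrite subrK.
set r := s - 1 in r0 sE *.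
have : r `^ k * (1 + k) * Gamma s - r `^ k * k * r * Gamma r <= 1 * Gamma (s + k).
  apply: Gamma_comb_le => //; first by rewrite ltr_pwDl.
  move=> t t0.
  have tr0 : 0 < r / t by rewrite divr_gt0.
  have h := powRN_tangent k0 tr0.
  have tD x y : t `^ (x + y) = t `^ x * t `^ y.
    by rewrite powRD// (gt_eqF t0) implybT.
  have -> : 1 * t `^ (s + k - 1) = t `^ (s - 1) * (r `^ k * (r / t) `^ (- k)).
    rewrite mul1r powRM ?ltW ?invr_gt0// [r `^ k * _]mulrA -powRD; last first.
      by rewrite (gt_eqF r0) implybT.
    rewrite subrr powRr0 mul1r -powR_inv1 ?ltW// -powRrM mulN1r opprK -tD.
    by congr powR; lra.
  have -> : t `^ (r - 1) = t `^ (s - 1) * t^-1.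
    by rewrite -powR_inv1 ?ltW// -tD.
  have := ler_wpM2l (powR_ge0 r k) h.
  move/(ler_wpM2l (powR_ge0 t (s - 1))); apply: le_trans.
  by rewrite le_eqVlt; apply/orP; left; apply/eqP; field; rewrite gt_eqF.
rewrite mul1r; apply: le_trans.
have gE : Gamma s = r * Gamma r by rewrite -sE GammaD1.
by rewrite le_eqVlt; apply/orP; left; apply/eqP; rewrite gE; ring.
Qed.

Lemma Gamma_shift (R : realType) (s : R) (N : nat) : 0 < s ->
  Gamma (s + N%:R) = \prod_(i < N) (s + i%:R) * Gamma s.
Proof.
move=> s0; elim: N => [|N IH]; first by rewrite addr0 big_ord0 mul1r.
rewrite -natr1 addrA GammaD1; last by rewrite ltr_pwDl.
by rewrite IH big_ord_recr/= mulrA [(_ + _) * _]mulrC.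
Qed.

#[local] Opaque Gamma.

(** * Gauss's product for quotients of Gamma values *)

Lemma cvg_1Ddivn_powR (R : realType) (c s : R) :
  (1 + c * n.+2%:R^-1) `^ s @[n --> \oo] --> (1 : R).
Proof.
have h : 1 + c * n.+2%:R^-1 @[n --> \oo] --> (1 : R).
  rewrite -[X in _ --> X]addr0; apply: cvgD; first exact: cvg_cst.
  rewrite -[X in _ --> X](mulr0 c); apply: cvgMl_tmp.
  by have := @cvg_harmonic R; rewrite -cvg_shiftS.
have p1 : t `^ s @[t --> (1 : R)] --> 1 `^ s by exact: powR_continuous.
rewrite powR1 in p1.
exact: cvg_comp h p1.
Qed.

(** [Gamma (s + N) / Gamma N] lies between [(N - 1)^s] and [(N + s)^s]. The
    index is [n + 2] because the lower bound needs [1 < N]. *)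
Lemma Gamma_asymptotic (R : realType) (s : R) : 0 < s ->
  Gamma (s + n.+2%:R) / (Gamma n.+2%:R * n.+2%:R `^ s) @[n --> \oo] --> (1 : R).
Proof.
move=> s0.
apply: (squeeze_cvgr _ (@cvg_1Ddivn_powR R (- 1) s) (@cvg_1Ddivn_powR R s s)).
near=> n; have := ltr1n R n.+2.
move: (n.+2%:R : R) => N /= N1.
have N0 : 0 < N by rewrite (lt_trans _ N1).
have GN0 := Gamma_gt0 N0.
have den0 : 0 < Gamma N * N `^ s by rewrite mulr_gt0// powR_gt0.
have N0' : N != 0 by rewrite gt_eqF.
have scale c : 0 <= N + c -> (1 + c * N^-1) `^ s * (Gamma N * N `^ s) =
    (N + c) `^ s * Gamma N.
  move=> Nc; have -> : N + c = (1 + c * N^-1) * N by field.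
  rewrite (@powRM _ (1 + c * N^-1) N) ?(ltW N0)//; first by ring.
  by rewrite -(pmulr_lge0 _ N0) mulrDl mul1r mulfVK.
apply/andP; split.
  rewrite ler_pdivlMr// scale ?subr_ge0 ?(ltW N1)//.
  by rewrite [s + N]addrC Gamma_ratio_ge// ltW.
rewrite ler_pdivrMr// scale; last by rewrite addr_ge0 ?ltW.
by rewrite [s + N]addrC Gamma_ratio_le// ltW.
Unshelve. all: by end_near. Qed.

(** The approximants of [Gamma u / Gamma v] in Gauss's product formula, with
    the factorials cancelled. *)
Definition Gamma_quot (R : realType) (N : nat) (u v : R) : R :=
  N%:R `^ (u - v) * \prod_(i < N) ((v + i%:R) / (u + i%:R)).

Lemma Gamma_quot_cvg (R : realType) (u v : R) : 0 < u -> 0 < v ->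
  Gamma_quot n.+2 u v @[n --> \oo] --> Gamma u / Gamma v.
Proof.
move=> u0 v0.
have Gu0 := Gamma_gt0 u0; have Gv0 := Gamma_gt0 v0.
pose rho s n : R := Gamma (s + n.+2%:R) / (Gamma n.+2%:R * n.+2%:R `^ s).
have -> : (fun n => Gamma_quot n.+2 u v) =
    (fun n => Gamma u / Gamma v * (rho v n * (rho u n)^-1)).
  apply/funext => n; rewrite /Gamma_quot /rho.
  have pp (w : R) : 0 < w -> 0 < \prod_(i < n.+2) (w + i%:R).
    by move=> w0; apply: prodr_gt0 => i _; rewrite ltr_pwDl.
  rewrite big_split/= prodfV !Gamma_shift//.
  have := pp _ u0; have := pp _ v0.
  set pv := \prod_(i < _) (v + _); set pu := \prod_(i < _) (u + _).
  have : 0 < n.+2%:R :> R by rewrite ltr0Sn.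
  move: (n.+2%:R : R) => N N0 pv0 pu0.
  rewrite powRB; last by rewrite (gt_eqF N0) implybT.
  have := Gamma_gt0 N0; have := powR_gt0 v N0; have := powR_gt0 u N0.
  move: (N `^ u) (N `^ v) (Gamma N) => a b c a0 b0 c0.
  by field; rewrite !gt_eqF.
rewrite -[X in _ --> X]mulr1; apply: cvgMl_tmp.
rewrite -[X in _ --> X](mulr1 1); apply: cvgM; first exact: Gamma_asymptotic.
rewrite -[X in _ --> X]invr1; apply: cvgV; first exact: oner_neq0.
exact: Gamma_asymptotic.
Qed.

(** * Monotonicity and the Euler equation *)

Lemma nonincreasing_is_derive (R : realType) (f df : R -> R) (x y : R) :
  x <= y ->
  (forall z : R, x <= z <= y -> is_derive z 1 f (df z)) ->
  (forall z, x <= z <= y -> df z <= 0) ->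
  f y <= f x.
Proof.
move=> xy fdf df0.
have io z : z \in `]x, y[%R -> x <= z <= y.
  by rewrite in_itv/= => /andP[/ltW -> /ltW ->].
apply: (@ler0_derive1_le_cc R f x y) => //; rewrite ?in_itv/= ?xy ?lexx//.
- by move=> z /io /fdf[].
- by move=> z /io zi; have [_ E] := fdf _ zi; rewrite derive1E E df0.
by apply: derivable_within_continuous => z; rewrite in_itv/= => /fdf[].
Qed.

(** The quantity [x^a h - C / (a - p) x^(a - p)] vanishes at [0] and has
    derivative [x^(a - 1) (S - C x^(- p)) <= 0]. With [p = C = 0] this says
    that [h] is nonpositive when [S] is. *)
Lemma euler_ode_decay (R : realType) (h dh S : R -> R) (a p C : R) :
  0 <= p -> p < a -> 0 <= C ->
  (forall x : R, is_derive x 1 h (dh x)) ->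
  (forall x, 0 < x -> x * dh x + a * h x = S x) ->
  (forall x, 0 < x -> x `^ p * S x <= C) ->
  forall x, 0 < x -> x `^ p * h x <= C / (a - p).
Proof.
move=> p0 pa C0 dhh ode SC x x0.
have a0 : 0 < a by exact: le_lt_trans pa.
have ap0 : 0 < a - p by rewrite subr_gt0.
pose phi t := t `^ a * h t - C / (a - p) * t `^ (a - p).
have phi0 : phi t @[t --> 0^'+] --> 0.
  have h0 : h t @[t --> (0 : R)^'+] --> h 0.
    by apply/cvg_at_right_filter; exact: derive_continuous (dhh 0).
  have c1 := cvgM (powR_cvg0 a0) h0; rewrite mul0r in c1.
  have c2 := cvgMl_tmp (a := C / (a - p)) (powR_cvg0 ap0); rewrite mulr0 in c2.
  by have := cvgB (c1 _) (c2 _); rewrite subrr; apply.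
pose dphi t := t `^ (a - 1) * S t - C * t `^ (a - p - 1).
have dphiE (t : R) : 0 < t -> is_derive t 1 phi (dphi t).
  move=> t0.
  have := is_derive1_powR a t0; have := is_derive1_powR (a - p) t0.
  move=> d1 d2; have d3 := dhh t.
  apply: is_derive_eq.
  rewrite /dphi -ode// /GRing.scale/=.
  have -> : t `^ a = t `^ (a - 1) * t.
    by rewrite mulrC mulr_powRB1// ltW.
  by field; rewrite gt_eqF.
have dphi_le0 t : 0 < t -> dphi t <= 0.
  move=> t0; rewrite subr_le0.
  have -> : t `^ (a - 1) = t `^ (a - p - 1) * t `^ p.
    rewrite -powRD; last by rewrite (gt_eqF t0) implybT.
    by congr powR; ring.
  by rewrite -mulrA [leRHS]mulrC ler_wpM2l ?powR_ge0// SC.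
have phi_le0 : phi x <= 0.
  apply: (ler_cvg_to (cvg_cst (phi x)) phi0).
  near=> t; have t0 : 0 < t by near: t; exact: nbhs_right_gt.
  have tx : t <= x by near: t; exact: nbhs_right_le.
  apply: (@nonincreasing_is_derive _ phi dphi) => // z /andP[tz _].
    by apply: dphiE; exact: lt_le_trans tz.
  by apply: dphi_le0; exact: lt_le_trans tz.
move: phi_le0; rewrite subr_le0.
have {1}-> : x `^ a = x `^ (a - p) * x `^ p.
  by rewrite -powRD ?subrK// (gt_eqF x0) implybT.
by rewrite -mulrA [leRHS]mulrC ler_pM2l// powR_gt0.
Unshelve. all: by end_near. Qed.

(** * Truncated alternating series *)

(** The argument is [- x], so that differentiation amounts to shifting [m] and
    changing the sign, and complete monotonicity becomes nonnegativity. *)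
Definition egf_sum (R : realType) (m : nat -> R) (K : nat) (x : R) : R :=
  pseries (fun n => m n / n`!%:R) (- x) K.

Lemma egf_sumS (R : realType) (m : nat -> R) (K : nat) (x : R) :
  egf_sum m K.+1 x = egf_sum m K x + m K / K`!%:R * (- x) ^+ K.
Proof. by rewrite /egf_sum /pseries /series/= big_nat_recr. Qed.

Lemma egf_sum0 (R : realType) (m : nat -> R) (x : R) : egf_sum m 0 x = 0.
Proof. by rewrite /egf_sum /pseries /series/= big_geq. Qed.

Lemma egf_sum_at0 (R : realType) (m : nat -> R) (K : nat) :
  egf_sum m K.+1 0 = m 0%N.
Proof.
elim: K => [|K IH].
  by rewrite egf_sumS egf_sum0 expr0 fact0 invr1 !mulr1 add0r.
by rewrite egf_sumS IH oppr0 expr0n mulr0 addr0.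
Qed.

Lemma eq_egf_sum (R : realType) (m m' : nat -> R) (K : nat) (x : R) :
  m =1 m' -> egf_sum m K x = egf_sum m' K x.
Proof. by move=> mm'; congr egf_sum; apply/funext. Qed.

Lemma egf_sumD (R : realType) (m m' : nat -> R) (K : nat) (x : R) :
  egf_sum (fun n => m n + m' n) K x = egf_sum m K x + egf_sum m' K x.
Proof.
elim: K => [|K IH]; first by rewrite !egf_sum0 addr0.
by rewrite !egf_sumS IH !mulrDl addrACA.
Qed.

Lemma egf_sumZ (R : realType) (c : R) (m : nat -> R) (K : nat) (x : R) :
  egf_sum (fun n => c * m n) K x = c * egf_sum m K x.
Proof.
elim: K => [|K IH]; first by rewrite !egf_sum0 mulr0.
by rewrite !egf_sumS IH mulrDr !mulrA.
Qed.

Lemma egf_sum_scale (R : realType) (c : R) (m : nat -> R) (K : nat) (x : R) :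
  egf_sum (fun n => c ^+ n * m n) K x = egf_sum m K (c * x).
Proof.
elim: K => [|K IH]; first by rewrite !egf_sum0.
by rewrite !egf_sumS IH -mulrN exprMn; congr (_ + _); ring.
Qed.

Lemma egf_sum_cvg (R : realType) (m : nat -> nat -> R) (l : nat -> R)
    (K : nat) (x : R) :
  (forall n, m N n @[N --> \oo] --> l n) ->
  egf_sum (m N) K x @[N --> \oo] --> egf_sum l K x.
Proof.
move=> ml; elim: K => [|K IH].
  by rewrite egf_sum0; under eq_fun do rewrite egf_sum0; exact: cvg_cst.
rewrite egf_sumS; under eq_fun do rewrite egf_sumS.
apply: cvgD => //; apply: cvgMr_tmp; exact: cvgMr_tmp.
Qed.

Lemma egf_sum_derive (R : realType) (m : nat -> R) (K : nat) (x : R) :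
  is_derive x 1 (egf_sum m K.+1) (- egf_sum (fun n => m n.+1) K x).
Proof.
elim: K => [|K IH].
  have -> : egf_sum m 1 = cst (m 0%N).
    apply/funext => y.
    by rewrite egf_sumS egf_sum0 expr0 fact0 invr1 !mulr1 add0r.
  by rewrite egf_sum0 oppr0; exact: is_derive_cst.
have -> : egf_sum m K.+2 =
    (fun y => egf_sum m K.+1 y + m K.+1 / K.+1`!%:R * (- y) ^+ K.+1).
  by apply/funext => y; rewrite egf_sumS.
set c := m K.+1 / _.
have dpow : is_derive x 1 (fun y : R => c * (- y) ^+ K.+1)
    (- (c * K.+1%:R * (- x) ^+ K)).
  have -> : (fun y : R => c * (- y) ^+ K.+1) = c \*: ((-%R : R -> R) ^+ K.+1).
    by apply/funext => y; rewrite /= exprfctE.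
  have dN := is_deriveNid x (1 : R).
  apply: is_derive_eq (is_deriveZ c (is_deriveX K.+1 dN)) _.
  by rewrite /GRing.scale/=; ring.
apply: is_derive_eq (is_deriveD IH dpow) _.
rewrite egf_sumS opprD; congr (_ - _ * _).
rewrite /c factS natrM.
have K0 : K`!%:R != 0 :> R by rewrite pnatr_eq0 -lt0n fact_gt0.
by field; rewrite K0 ?natr1 ?nat1r pnatr_eq0.
Qed.

(** Dividing the [n]-th coefficient by [n + a] thus amounts to solving the Euler
    equation [x h' + a h = g]. *)
Lemma egf_sum_euler (R : realType) (a : R) (m : nat -> R) (K : nat) (x : R) :
  x * - egf_sum (fun n => m n.+1) K x + a * egf_sum m K.+1 x =
  egf_sum (fun n => (n%:R + a) * m n) K.+1 x.
Proof.
elim: K => [|K IH].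
  by rewrite !egf_sumS !egf_sum0 add0r; ring.
rewrite [RHS]egf_sumS -IH [egf_sum _ K.+1 x]egf_sumS [egf_sum m K.+2 x]egf_sumS.
rewrite factS natrM exprS.
have K0 : K`!%:R != 0 :> R by rewrite pnatr_eq0 -lt0n fact_gt0.
by field; rewrite K0 ?natr1 ?nat1r pnatr_eq0.
Qed.

(** As [(n + b) / (n + a) = 1 + (b - a) / (n + a)], the new sum is the old one
    plus [b - a] times a solution of the Euler equation whose right-hand side
    is the old one. The bound [C] gets multiplied by the value of
    [(n + b) / (n + a)] at [n = - p]. *)
Lemma egf_sum_factor_le (R : realType) (m : nat -> R) (K : nat) (a b p C : R) :
  0 <= p -> p < a -> a <= b -> 0 <= C ->
  (forall x, 0 < x -> x `^ p * egf_sum m K.+1 x <= C) ->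
  forall x, 0 < x ->
  x `^ p * egf_sum (fun n => (n%:R + b) / (n%:R + a) * m n) K.+1 x <=
  (b - p) / (a - p) * C.
Proof.
move=> p0 pa ab C0 mC x x0.
have a0 : 0 < a by exact: le_lt_trans pa.
have na0 n : n%:R + a != 0 by rewrite gt_eqF// ltr_wpDl.
pose m' n := m n / (n%:R + a).
have m'C : x `^ p * egf_sum m' K.+1 x <= C / (a - p).
  apply: (@euler_ode_decay _ _ _ (egf_sum m K.+1) a p C p0 pa C0
    (@egf_sum_derive _ m' K)) => // y y0.
  rewrite egf_sum_euler; apply: eq_egf_sum => n.
  by rewrite /m' mulrC divfK.
rewrite (@eq_egf_sum _ _ (fun n => m n + (b - a) * m' n)); last first.
  by move=> n; rewrite /m'; field.
rewrite egf_sumD egf_sumZ mulrDr mulrCA.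
have -> : (b - p) / (a - p) * C = C + (b - a) * (C / (a - p)).
  by field; rewrite subr_eq0 gt_eqF.
by rewrite lerD ?mC// ler_wpM2l// subr_ge0.
Qed.

(** The derivative of the remainder at level [K + 1] is minus the remainder at
    level [K], and the remainders vanish at [0]. *)
Lemma expR_egf_sum (R : realType) (K : nat) (x : R) : 0 <= x ->
  0 <= (-1) ^+ K * (expR (- x) - egf_sum (fun=> 1) K x).
Proof.
elim: K x => [|K IH] x x0; first by rewrite egf_sum0 subr0 mul1r expR_ge0.
pose g (y : R) := - ((-1) ^+ K.+1 * (expR (- y) - egf_sum (fun=> 1) K.+1 y)).
suff : g x <= g 0.
  by rewrite /g egf_sum_at0 oppr0 expR0 subrr mulr0 oppr0 oppr_le0.
pose dg (y : R) := - ((-1) ^+ K * (expR (- y) - egf_sum (fun=> 1) K y)).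
apply: (@nonincreasing_is_derive _ g dg 0 x x0) => y /andP[y0 _]; last first.
  by rewrite oppr_le0 IH.
have d := @egf_sum_derive R (fun=> 1) K y.
apply: is_derive_eq.
by rewrite /dg /GRing.scale/= exprS; ring.
Qed.

(** * The moments and the bounds on their truncated series *)

(** When the function is completely monotone, these are, up to the factor
    [Gamma gamma], the moments of the measure that it is the Laplace transform
    of. *)
Definition ML_moment (R : realType) (alpha beta gamma kappa : R) (n : nat) : R :=
  Gamma (gamma + kappa * n%:R) / Gamma (beta + alpha * n%:R).

Section truncated_bound.
Variables (R : realType) (alpha beta gamma kappa p sigma C : R) (K : nat).
Hypotheses (alpha_gt0 : 0 < alpha) (kappa_gt0 : 0 < kappa).
Hypotheses (gamma_gt0 : 0 < gamma).
Hypotheses (le_ak : alpha <= kappa) (le_agkb : alpha * gamma <= kappa * beta).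
Hypotheses (p0 : 0 <= p) (pgamma : kappa * p < gamma) (C0 : 0 <= C).
Hypothesis base : forall x, 0 < x ->
  x `^ p * egf_sum (fun=> sigma) K.+1 x <= C.

Lemma alphap_lt_beta : alpha * p < beta.
Proof.
rewrite -(ltr_pM2l kappa_gt0); apply: lt_le_trans le_agkb.
by rewrite mulrCA ltr_pM2l.
Qed.

(** The [j]-th factor is [alpha / kappa] times [(n + b) / (n + a)] with
    [b = (beta + j) / alpha] and [a = (gamma + j) / kappa], so that its zero is
    not to the right of its pole, which is to the left of [- p]. *)
Lemma truncated_product_bound (c : R) (j : nat) : 0 < c ->
  forall x, 0 < x ->
  x `^ p * egf_sum (fun n => (\prod_(i < j)
      ((beta + alpha * n%:R + i%:R) / (gamma + kappa * n%:R + i%:R))) *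
      (c ^+ n * sigma)) K.+1 x <=
  (\prod_(i < j) ((beta - alpha * p + i%:R) / (gamma - kappa * p + i%:R))) *
    (c `^ (- p) * C).
Proof.
move=> c0; elim: j => [|j IH] x x0.
  rewrite big_ord0 mul1r (@eq_egf_sum _ _ (fun n => c ^+ n * sigma)); last first.
    by move=> n; rewrite big_ord0 mul1r.
  rewrite egf_sum_scale.
  have -> : x `^ p = c `^ (- p) * (c * x) `^ p.
    rewrite powRM ?ltW// mulrA -powRD; last by rewrite (gt_eqF c0) implybT.
    by rewrite addNr powRr0 mul1r.
  by rewrite -mulrA ler_wpM2l ?powR_ge0// base// mulr_gt0.
have ka0 : 0 < kappa^-1 by rewrite invr_gt0.
pose a := (gamma + j%:R) / kappa; pose b := (beta + j%:R) / alpha.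
have pa : p < a.
  by rewrite ltr_pdivlMr// mulrC; apply: lt_le_trans pgamma _; rewrite lerDl.
have ab : a <= b.
  rewrite ler_pdivrMr// mulrAC ler_pdivlMr// !mulrDl.
  by move: le_agkb (ler_wpM2r (ler0n R j) le_ak); lra.
rewrite big_ord_recr/=.
set A := \prod_(i < j) _ in IH *.
have D0 : 0 <= A * (c `^ (- p) * C).
  apply: mulr_ge0; last by rewrite mulr_ge0 ?powR_ge0.
  apply: prodr_ge0 => i _; apply: divr_ge0.
    by rewrite addr_ge0// subr_ge0 ltW// alphap_lt_beta.
  by rewrite addr_ge0// subr_ge0 ltW.
have := egf_sum_factor_le p0 pa ab D0 IH x0.
move/(ler_wpM2l (divr_ge0 (ltW alpha_gt0) (ltW kappa_gt0))).
rewrite mulrCA => h.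
have nk n : gamma + kappa * n%:R + j%:R != 0.
  by rewrite gt_eqF// -addrA ltr_pwDl// addr_ge0// mulr_ge0// ltW.
have kp : gamma - kappa * p + j%:R != 0.
  by rewrite gt_eqF// ltr_pwDl// subr_gt0.
have k0 : kappa != 0 by rewrite gt_eqF.
have al0 : alpha != 0 by rewrite gt_eqF.
have nk' n : n%:R + a != 0.
  by rewrite gt_eqF// ltr_wpDl// divr_gt0// ltr_pwDl.
have aE n : n%:R + a = (gamma + kappa * n%:R + j%:R) / kappa by rewrite /a; field.
have bE n : n%:R + b = (beta + alpha * n%:R + j%:R) / alpha by rewrite /b; field.
have apE : a - p = (gamma - kappa * p + j%:R) / kappa by rewrite /a; field.
have bpE : b - p = (beta - alpha * p + j%:R) / alpha by rewrite /b; field.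
move: h; rewrite apE bpE.
congr (_ <= _).
- congr (_ * _); rewrite -egf_sumZ; apply: eq_egf_sum => n.
  rewrite big_ord_recr/= aE bE.
  set P := \prod_(i < j) _; move: P => P.
  by field; rewrite nk k0 al0.
- by field; rewrite kp k0 al0.
Qed.

(** The products converge to the moments and, evaluated at [n = - p], to the
    quotient of Gamma values in the bound. Taking [sigma = 1] or [sigma = -1]
    turns an upper or a lower bound for truncated exponentials into one for
    truncated series of moments. *)
Lemma truncated_bound x : 0 < x ->
  x `^ p * egf_sum (fun n => ML_moment alpha beta gamma kappa n * sigma) K.+1 x <=
  Gamma (gamma - kappa * p) / Gamma (beta - alpha * p) * C.
Proof.
move=> x0.
have b0 : 0 < beta.
  have : 0 < kappa * beta by apply: lt_le_trans le_agkb; rewrite mulr_gt0.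
  by rewrite pmulr_rgt0.
pose m N n : R :=
  Gamma_quot N.+2 (gamma + kappa * n%:R) (beta + alpha * n%:R) * sigma.
have mcvg n : m N n @[N --> \oo] --> ML_moment alpha beta gamma kappa n * sigma.
  apply: cvgMr_tmp; apply: Gamma_quot_cvg.
    by rewrite ltr_pwDl// mulr_ge0// ltW.
  by rewrite ltr_pwDl// mulr_ge0// ltW.
have lcvg : x `^ p * egf_sum (m N) K.+1 x @[N --> \oo] -->
    x `^ p * egf_sum (fun n => ML_moment alpha beta gamma kappa n * sigma) K.+1 x.
  by apply: cvgMl_tmp; exact: egf_sum_cvg.
have rcvg : Gamma_quot N.+2 (gamma - kappa * p) (beta - alpha * p) * C
    @[N --> \oo] --> Gamma (gamma - kappa * p) / Gamma (beta - alpha * p) * C.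
  by apply: cvgMr_tmp; apply: Gamma_quot_cvg; rewrite subr_gt0// alphap_lt_beta.
apply: (ler_cvg_to lcvg rcvg); apply: nearW => N.
have N0 : 0 < N.+2%:R :> R by rewrite ltr0Sn.
pose c : R := N.+2%:R `^ (kappa - alpha).
have c0 : 0 < c by rewrite powR_gt0.
have := truncated_product_bound N.+2 c0 x0.
move/(ler_wpM2l (powR_ge0 N.+2%:R (gamma - beta))).
rewrite mulrCA.
have pD (s t : R) : N.+2%:R `^ s * N.+2%:R `^ t = N.+2%:R `^ (s + t).
  by rewrite powRD// (gt_eqF N0) implybT.
congr (_ <= _).
- congr (_ * _); rewrite -egf_sumZ; apply: eq_egf_sum => n.
  rewrite /m /Gamma_quot.
  have -> : N.+2%:R `^ (gamma + kappa * n%:R - (beta + alpha * n%:R)) =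
      N.+2%:R `^ (gamma - beta) * c ^+ n.
    rewrite -powR_mulrn ?powR_ge0// /c -powRrM pD.
    by congr powR; ring.
  by move: (\prod_(i < _) _) (c ^+ n) (N.+2%:R `^ _) => P Q S; ring.
- rewrite /Gamma_quot /c -powRrM.
  have -> : N.+2%:R `^ (gamma - kappa * p - (beta - alpha * p)) =
      N.+2%:R `^ (gamma - beta) * N.+2%:R `^ ((kappa - alpha) * - p).
    by rewrite pD; congr powR; ring.
  by move: (\prod_(i < _) _) (N.+2%:R `^ _) (N.+2%:R `^ _) => P Q S; ring.
Qed.
End truncated_bound.

(** * Alternating exponential series *)

Definition entire_egf (R : realType) (m : nat -> R) : Prop :=
  forall x, cvgn (fun K => egf_sum m K x).

Definition egf (R : realType) (m : nat -> R) (x : R) : R :=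
  limn (fun K => egf_sum m K x).

Lemma egf_sum_cvg_egf (R : realType) (m : nat -> R) (x : R) :
  entire_egf m -> egf_sum m K x @[K --> \oo] --> egf m x.
Proof. by move=> em; exact: em. Qed.

Lemma egf_at0 (R : realType) (m : nat -> R) : egf m 0 = m 0%N.
Proof.
apply/cvg_lim => //; rewrite -cvg_shiftS.
under eq_fun do rewrite egf_sum_at0; exact: cvg_cst.
Qed.

Lemma egf_derive (R : realType) (m : nat -> R) (x : R) :
  entire_egf m -> entire_egf (fun n => m n.+1) ->
  entire_egf (fun n => m n.+2) ->
  is_derive x 1 (egf m) (- egf (fun n => m n.+1) x).
Proof.
move=> e0 e1 e2.
pose c n : R := m n / n`!%:R.
have dE (u : nat -> R) :
    pseries_diffs (fun n => u n / n`!%:R) = (fun n => u n.+1 / n`!%:R).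
  apply/funext => n; rewrite /pseries_diffs factS natrM.
  have K0 : n`!%:R != 0 :> R by rewrite pnatr_eq0 -lt0n fact_gt0.
  by field; rewrite K0 ?natr1 ?nat1r pnatr_eq0.
have cv (u : nat -> R) : entire_egf u ->
    cvgn (pseries (fun n => u n / n`!%:R) (`|x| + 1)).
  by move/(_ (- (`|x| + 1))); rewrite /egf_sum opprK.
have := @pseries_snd_diffs R c (`|x| + 1) (- x).
rewrite /c !dE => /(_ (cv _ e0) (cv _ e1) (cv _ e2)).
rewrite normrN [X in _ < X -> _]ger0_norm ?addr_ge0// ltrDl ltr01.
move=> /(_ isT) d.
have dN := is_deriveNid x (1 : R).
have := is_derive1_comp d dN.
by move/is_derive_eq; apply; rewrite mulrN1.
Qed.

Lemma egf_euler (R : realType) (a : R) (m : nat -> R) (x : R) :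
  entire_egf m -> entire_egf (fun n => m n.+1) ->
  x * - egf (fun n => m n.+1) x + a * egf m x =
  egf (fun n => (n%:R + a) * m n) x.
Proof.
move=> e0 e1; apply/esym/cvg_lim => //; rewrite -cvg_shiftS.
under eq_fun do rewrite -egf_sum_euler.
apply: cvgD; apply: cvgMl_tmp.
  by apply: cvgN; exact: egf_sum_cvg_egf.
by rewrite (cvg_shiftS (fun K => egf_sum m K x)); exact: egf_sum_cvg_egf.
Qed.

(** With [e = 1 / (2 (|x| + 1))] the terms of the series are eventually halved
    at each step. *)
Lemma entire_egf_ratio (R : realType) (m : nat -> R) :
  (forall e, 0 < e -> \forall n \near \oo,
     `|m n.+1| <= e * n.+1%:R * `|m n|) ->
  entire_egf m.
Proof.
move=> ratio x.
pose e : R := (2 * (`|x| + 1))^-1.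
have x1 : 0 < `|x| + 1 by rewrite ltr_wpDl.
have e0 : 0 < e by rewrite invr_gt0 mulr_gt0.
pose b n : R := `|m n / n`!%:R * (- x) ^+ n| * 2 ^+ n.
have b0 n : 0 <= b n by rewrite mulr_ge0.
have [N _ bN] : \forall n \near \oo, b n.+1 <= b n.
  apply: filterS (ratio e e0) => n /= rn.
  rewrite /b !normrM !normrX !normfV !normrN factS natrM exprS [2 ^+ n.+1]exprS.
  rewrite normrM !normr_nat.
  have f0 : 0 < n`!%:R :> R by rewrite ltr0n fact_gt0.
  have n0 : 0 < n.+1%:R :> R by rewrite ltr0n.
  set q := `|x| ^+ n * 2 ^+ n / n`!%:R.
  have q0 : 0 <= q by rewrite divr_ge0 ?mulr_ge0 ?exprn_ge0// ltW.
  have -> : `|m n.+1| / (n.+1%:R * n`!%:R) * (`|x| * `|x| ^+ n) * (2 * 2 ^+ n) =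
      `|m n.+1| / n.+1%:R * q * (2 * `|x|).
    by rewrite /q; field; rewrite !gt_eqF.
  have -> : `|m n| / n`!%:R * `|x| ^+ n * 2 ^+ n = `|m n| * q.
    by rewrite /q; field; rewrite gt_eqF.
  apply: (@le_trans _ _ (e * `|m n| * q * (2 * `|x|))).
    rewrite ler_wpM2r ?mulr_ge0// ler_wpM2r// ler_pdivrMr//.
    by rewrite mulrAC.
  have -> : e * `|m n| * q * (2 * `|x|) = `|m n| * q * (e * (2 * `|x|)) by ring.
  rewrite ler_piMr ?mulr_ge0// mulrC ler_pdivrMr ?mulr_gt0// mul1r.
  by rewrite ler_wpM2l// lerDl.
pose C := \sum_(i < N.+1) b i.
have bC n : b n <= C.
  have bi i : (i < N.+1)%N -> b i <= C.
    move=> iN; rewrite /C (bigD1 (Ordinal iN))//= lerDl.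
    by apply: sumr_ge0 => k _.
  have [nN|Nn] := leqP n N; first exact: bi.
  apply: (@le_trans _ _ (b N)); last exact: bi.
  rewrite -(subnK (ltnW Nn)); elim: (n - N)%N => // k IH.
  by rewrite addSn; apply: le_trans IH; apply: bN => /=; rewrite leq_addl.
have C0 : 0 <= C by exact: le_trans (bC 0%N).
apply: (@normed_cvg R R).
apply: (@series_le_cvg R _ (geometric C 2^-1)).
- by move=> n; rewrite /=.
- by move=> n; rewrite mulr_ge0// exprn_ge0// invr_ge0.
- move=> n /=; rewrite exprVn ler_pdivlMr ?exprn_gt0//; exact: bC.
apply: is_cvg_geometric_series.
by rewrite ger0_norm ?invr_ge0// invf_lt1// ltr1n.
Qed.

Lemma powRN_cvg0 (R : realType) (d : R) : 0 < d ->
  n%:R `^ (- d) @[n --> \oo] --> (0 : R).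
Proof.
move=> d0; apply/cvgrPdist_le => e e0.
near=> n.
rewrite sub0r normrN ger0_norm ?powR_ge0//.
have M0 : 0 < e^-1 `^ d^-1 by rewrite powR_gt0// invr_gt0.
have Mn : e^-1 `^ d^-1 <= n%:R by near: n; exact: nbhs_infty_ger.
have n0 : 0 < n%:R :> R by exact: lt_le_trans Mn.
rewrite powRN -[leRHS]invrK lef_pV2 ?posrE ?powR_gt0 ?invr_gt0//.
have -> : e^-1 = (e^-1 `^ d^-1) `^ d.
  by rewrite -powRrM mulVf ?gt_eqF// powRr1// invr_ge0 ltW.
by apply: ge0_ler_powR => //; rewrite ?nnegrE; exact: ltW.
Unshelve. all: by end_near. Qed.

(** * Growth of the moments *)

Lemma ML_coefE (R : realType) (alpha beta gamma kappa : R) (n : nat) :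
  ML_coef alpha beta gamma kappa n =
  (Gamma gamma)^-1 * ML_moment alpha beta gamma kappa n / n`!%:R.
Proof. by rewrite /ML_coef /ML_moment !invfM; ring. Qed.

Section moments.
Variables (R : realType) (alpha kappa : R).
Hypotheses (alpha_gt0 : 0 < alpha) (kappa_gt0 : 0 < kappa).
Local Notation M beta gamma := (ML_moment alpha beta gamma kappa).

Lemma ML_moment_gt0 (beta gamma : R) (n : nat) :
  0 < beta -> 0 < gamma -> 0 < M beta gamma n.
Proof.
move=> b0 g0; rewrite divr_gt0// Gamma_gt0// ltr_pwDl// mulr_ge0// ltW//.
Qed.

(** Differentiation of the series shifts the moments, and so stays within the
    family. *)
Lemma ML_moment_shift (beta gamma : R) :
  (fun n => M beta gamma n.+1) = M (beta + alpha) (gamma + kappa).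
Proof.
apply/funext => n.
by rewrite /ML_moment -natr1 !mulrDr !mulr1 !addrA ![_ + _ + _ * _]addrAC.
Qed.

Lemma ML_moment_shiftn (beta gamma : R) (j n : nat) :
  M (beta + alpha *+ j) (gamma + kappa *+ j) n = M beta gamma (j + n).
Proof.
rewrite /ML_moment natrD !mulrDr !addrA.
by rewrite -[alpha *+ j]mulr_natr -[kappa *+ j]mulr_natr.
Qed.

(** The recurrence of Gamma: raising [beta] by [1] divides the [n]-th moment by
    [beta + alpha n]. *)
Lemma ML_moment_succ (beta gamma : R) : 0 < beta ->
  (fun n => (n%:R + beta / alpha) * M (beta + 1) gamma n) =
  (fun n => alpha^-1 * M beta gamma n).
Proof.
move=> b0; apply/funext => n; rewrite /ML_moment addrAC GammaD1; last first.
  by rewrite ltr_pwDl// mulr_ge0// ltW.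
have v0 : 0 < beta + alpha * n%:R by rewrite ltr_pwDl// mulr_ge0// ltW.
have := Gamma_gt0 v0; move: v0; move: (Gamma (_ + _)) => G v0 G0.
move: (Gamma _) => G'.
have -> : n%:R + beta / alpha = (beta + alpha * n%:R) / alpha.
  by field; rewrite gt_eqF.
by field; rewrite !gt_eqF.
Qed.

Lemma ML_moment_ratio (beta gamma : R) : 0 < beta -> 0 < gamma ->
  exists2 C : R, 0 <= C & \forall n \near \oo,
    M beta gamma n.+1 <= C * n%:R `^ (kappa - alpha) * M beta gamma n.
Proof.
move=> b0 g0.
pose A := gamma + kappa + kappa; pose B := alpha / 2.
have A0 : 0 < A by rewrite !addr_gt0.
have B0 : 0 < B by rewrite divr_gt0.
exists (A `^ kappa / B `^ alpha); first by rewrite divr_ge0 ?powR_ge0.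
near=> n.
have n2 : 2 / alpha <= n%:R by near: n; exact: nbhs_infty_ger.
have n1 : 1 <= n%:R :> R by near: n; exact: nbhs_infty_ger.
have n0 : 0 < n%:R :> R by exact: lt_le_trans n1.
rewrite -[M _ _ _.+1]/((fun n => M beta gamma n.+1) n) ML_moment_shift /ML_moment.
rewrite [gamma + kappa + _]addrAC [beta + alpha + _]addrAC.
set u := gamma + kappa * n%:R; set v := beta + alpha * n%:R.
have u0 : 0 < u by rewrite addr_gt0// mulr_gt0.
have an2 : 2 <= alpha * n%:R by rewrite mulrC -ler_pdivrMr.
have v1 : 1 < v by rewrite /v; lra.
have v0 : 0 < v by exact: lt_trans v1.
have Gu := Gamma_ratio_le u0 (ltW kappa_gt0).
have Gv := Gamma_ratio_ge v1 (ltW alpha_gt0).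
have Gu0 := Gamma_gt0 u0; have Gv0 := Gamma_gt0 v0.
have Gva0 : 0 < Gamma (v + alpha) by rewrite Gamma_gt0// addr_gt0.
have uA : (u + kappa) `^ kappa <= A `^ kappa * n%:R `^ kappa.
  rewrite -powRM ?(ltW A0)//; apply: ge0_ler_powR; rewrite ?nnegrE.
  - exact: ltW.
  - by rewrite ltW// addr_gt0.
  - by rewrite mulr_ge0// ltW.
  - rewrite /u /A !mulrDl -addrA [kappa * _]mulrC [_ * kappa]mulrC addrA.
    by rewrite !lerD// ler_peMr// ltW.
have vB : B `^ alpha * n%:R `^ alpha <= (v - 1) `^ alpha.
  rewrite -powRM ?(ltW B0)//; apply: ge0_ler_powR; rewrite ?nnegrE.
  - exact: ltW.
  - by rewrite mulr_ge0// ltW.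
  - by rewrite subr_ge0 ltW.
  - rewrite /B /v [alpha / 2 * _]mulrAC; move: an2 b0.
    by move: (alpha * _) => t; clear Gu Gv Gu0 Gv0 Gva0 uA; lra.
rewrite powRB; last by rewrite (gt_eqF n0) implybT.
move: Gu Gv Gu0 Gv0 Gva0 uA vB.
have := powR_gt0 alpha n0; have := powR_gt0 alpha B0.
have := powR_ge0 A kappa; have := powR_ge0 n%:R kappa.
move: (Gamma (u + kappa)) (Gamma u) (Gamma (v + alpha)) (Gamma v).
move: (n%:R `^ alpha) (n%:R `^ kappa) (B `^ alpha) (A `^ kappa).
move: ((u + kappa) `^ kappa) ((v - 1) `^ alpha) => U V na nk Ba Ak Gu' Gu Gv' Gv.
move=> nk0 Ak0 Ba0 na0 hu hv Gu0 Gv0 Gva0 hU hV.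
rewrite ler_pdivrMr//.
have -> : Ak / Ba * (nk / na) * (Gu / Gv) * Gv' =
    Ak * nk * Gu * (Gv' / (Ba * na * Gv)).
  by field; rewrite !gt_eqF.
have Gu'U : Gu' <= Ak * nk * Gu.
  by apply: le_trans hu _; rewrite ler_wpM2r// ltW.
apply: le_trans Gu'U _.
have AU : 0 <= Ak * nk * Gu by rewrite !mulr_ge0// ltW.
apply: ler_peMr => //; rewrite ler_pdivlMr ?mul1r ?mulr_gt0//.
by apply: le_trans hv; rewrite ler_wpM2r// ltW.
Unshelve. all: by end_near. Qed.

#[local] Opaque ML_moment.

Lemma ML_moment_entire (beta gamma : R) :
  0 < beta -> 0 < gamma -> 0 < 1 + alpha - kappa ->
  entire_egf (M beta gamma).
Proof.
move=> b0 g0 d0; apply: entire_egf_ratio => e e0.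
have [C C0 hC] := ML_moment_ratio b0 g0.
have : C * n%:R `^ (- (1 + alpha - kappa)) @[n --> \oo] --> (0 : R).
  by rewrite -[X in _ --> X](mulr0 C); apply: cvgMl_tmp; exact: powRN_cvg0.
move/cvgrPdist_le => /(_ e e0) small.
near=> n.
have n1 : 1 <= n%:R :> R by near: n; exact: nbhs_infty_ger.
have n0 : 0 < n%:R :> R by exact: lt_le_trans n1.
have h1 : M beta gamma n.+1 <= C * n%:R `^ (kappa - alpha) * M beta gamma n.
  by near: n; exact: hC.
have h2 : `|0 - C * n%:R `^ (- (1 + alpha - kappa))| <= e.
  by near: n; exact: small.
rewrite sub0r normrN ger0_norm ?mulr_ge0 ?powR_ge0// in h2.
have m0 := ML_moment_gt0 n b0 g0; have m1 := ML_moment_gt0 n.+1 b0 g0.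
rewrite !gtr0_norm//; apply: le_trans h1 _; rewrite ler_wpM2r ?(ltW m0)//.
have -> : n%:R `^ (kappa - alpha) = n%:R `^ (- (1 + alpha - kappa)) * n%:R.
  rewrite -{3}(powRr1 (ltW n0)) -powRD; last by rewrite (gt_eqF n0) implybT.
  by congr powR; ring.
rewrite mulrA; apply: ler_pM => //.
  by rewrite mulr_ge0 ?powR_ge0.
by rewrite ler_nat.
Unshelve. all: by end_near. Qed.

End moments.

(** * The family of generalized Mittag-Leffler functions *)

Section ML_family.
Variables (R : realType) (alpha kappa : R).
Hypotheses (alpha_gt0 : 0 < alpha) (kappa_gt0 : 0 < kappa).
Hypothesis Delta_gt0 : 0 < 1 + alpha - kappa.
Local Notation M beta gamma := (ML_moment alpha beta gamma kappa).
Local Notation E beta gamma := (egf (M beta gamma)).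

Lemma ML_egf_derive (beta gamma x : R) : 0 < beta -> 0 < gamma ->
  is_derive x 1 (E beta gamma) (- E (beta + alpha) (gamma + kappa) x).
Proof.
move=> b0 g0.
have entire j : entire_egf (M (beta + alpha *+ j) (gamma + kappa *+ j)).
  by apply: ML_moment_entire; rewrite // ltr_wpDr// mulrn_wge0// ltW.
have := @egf_derive R (M beta gamma) x.
have -> : (fun n => M beta gamma n.+2) =
    (fun n => M (beta + alpha) (gamma + kappa) n.+1).
  by apply/funext => n; rewrite -ML_moment_shift.
rewrite !ML_moment_shift; apply.
- by have := entire 0%N; rewrite !mulr0n !addr0.
- exact: entire 1%N.
- by have := entire 2%N; rewrite !mulrS !mulr0n !addr0 !addrA.
Qed.

Lemma ML_egf_derive1n (c beta gamma : R) (n : nat) : 0 < beta -> 0 < gamma ->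
  (fun x => c * E beta gamma x)^`(n)%classic =
  (fun x => c * (-1) ^+ n * E (beta + alpha *+ n) (gamma + kappa *+ n) x) /\
  forall x, derivable (fun x => c * E beta gamma x)^`(n)%classic x 1.
Proof.
move=> b0 g0.
have step k (x : R) := is_deriveZ (c * (-1) ^+ k) (@ML_egf_derive
  (beta + alpha *+ k) (gamma + kappa *+ k) x
  (ltr_wpDr (mulrn_wge0 k (ltW alpha_gt0)) b0)
  (ltr_wpDr (mulrn_wge0 k (ltW kappa_gt0)) g0)).
suff nE : (fun x => c * E beta gamma x)^`(n)%classic =
    (fun x => c * (-1) ^+ n * E (beta + alpha *+ n) (gamma + kappa *+ n) x).
  by split=> // x; rewrite nE; case: (step n x).
elim: n => [|n IH].
  by apply/funext => x; rewrite /= expr0 mulr1 !mulr0n !addr0.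
rewrite derive1nS IH; apply/funext => x.
rewrite derive1E; have [_ ->] := step n x.
by rewrite /GRing.scale/= !mulrSr !addrA exprSr !mulrN1 !mulrN mulNr.
Qed.

Lemma completely_monotone_ML_egf (c beta gamma : R) :
  0 < c -> 0 < beta -> 0 < gamma ->
  completely_monotone (fun x => c * E beta gamma x) <->
  (forall n x, 0 < x -> 0 <= E (beta + alpha *+ n) (gamma + kappa *+ n) x).
Proof.
move=> c0 b0 g0.
have sg n x : (-1) ^+ n * (fun x => c * E beta gamma x)^`(n)%classic x =
    c * E (beta + alpha *+ n) (gamma + kappa *+ n) x.
  have [-> _] := ML_egf_derive1n c n b0 g0.
  rewrite mulrA [c * _]mulrC mulrA -exprD addnn -mul2n.
  by rewrite exprM sqrrN !expr1n mul1r.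
split=> [[_ h] n x x0|h]; first by have := h n x x0; rewrite sg pmulr_rge0.
split=> [n x x0|n x x0]; last by rewrite sg mulr_ge0 ?h// ltW.
by have [_] := ML_egf_derive1n c n b0 g0.
Qed.

Lemma ML_egf_euler (beta gamma x : R) : 0 < beta -> 0 < gamma ->
  x * - E (beta + 1 + alpha) (gamma + kappa) x +
    beta / alpha * E (beta + 1) gamma x =
  alpha^-1 * E beta gamma x.
Proof.
move=> b0 g0; have b1 : 0 < beta + 1 by rewrite addr_gt0.
rewrite -ML_moment_shift egf_euler; last 2 first.
- exact: ML_moment_entire.
- by rewrite ML_moment_shift; apply: ML_moment_entire; rewrite // addr_gt0.
rewrite ML_moment_succ//.
apply/cvg_lim => //; under eq_fun do rewrite egf_sumZ.
by apply: cvgMl_tmp; apply: egf_sum_cvg_egf; exact: ML_moment_entire.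
Qed.

Lemma cvg_odd_even (u : nat -> R) (l : R) :
  u n @[n --> \oo] --> l ->
  (u k.*2.+1 @[k --> \oo] --> l) /\ (u k.*2 @[k --> \oo] --> l).
Proof.
move=> ul; split; apply: cvg_comp ul; move=> A [N _ NA]; exists N => // k /= Nk;
  apply: NA => /=; rewrite -addnn.
  by rewrite (leq_trans Nk)// -addnS leq_addr.
by rewrite (leq_trans Nk)// leq_addr.
Qed.

(** The sums with an odd number of terms of the exponential series are
    nonnegative, so [truncated_bound] with [p = C = 0] and [sigma = -1] makes
    those of the series of moments nonnegative. *)
Lemma ML_egf_ge0 (beta gamma x : R) :
  0 < beta -> 0 < gamma ->
  alpha <= kappa -> alpha * gamma <= kappa * beta -> 0 < x ->
  0 <= E beta gamma x.
Proof.
move=> b0 g0 ak agkb x0.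
have em := ML_moment_entire alpha_gt0 kappa_gt0 b0 g0 Delta_gt0.
have [cv _] := cvg_odd_even (egf_sum_cvg_egf (x := x) em).
apply: (ler_cvg_to (cvg_cst 0) cv); apply: nearW => k.
have base (y : R) : 0 < y -> y `^ 0 * egf_sum (fun=> -1) k.*2.+1 y <= 0.
  move=> y0; rewrite powRr0 mul1r.
  rewrite (@eq_egf_sum _ _ (fun=> -1 * 1)); last by move=> n; rewrite mulr1.
  rewrite egf_sumZ mulN1r oppr_le0.
  have := expR_egf_sum k.*2.+1 (ltW y0).
  rewrite exprS -muln2 exprM sqrr_sign mulr1 mulN1r opprB subr_ge0.
  by apply: le_trans; exact: expR_ge0.
have := truncated_bound alpha_gt0 kappa_gt0 g0 ak agkb
  (lexx 0) _ (lexx 0) base x0.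
rewrite mulr0 => /(_ g0).
rewrite powRr0 mul1r mulr0.
rewrite (@eq_egf_sum _ _ (fun n => -1 * M beta gamma n)); last first.
  by move=> n; rewrite mulrN1 mulN1r.
by rewrite egf_sumZ mulN1r oppr_le0.
Qed.

(** The sums with an even number of terms of the exponential series are at most
    [exp (- x)], and [x^p exp (- x)] is bounded. *)
Lemma ML_egf_decay (beta gamma p : R) :
  0 < beta -> 0 < gamma ->
  alpha <= kappa -> alpha * gamma <= kappa * beta ->
  0 < p -> kappa * p < gamma ->
  exists C, forall x, 0 < x -> x `^ p * E beta gamma x <= C.
Proof.
move=> b0 g0 ak agkb p0 pg.
exists (Gamma (gamma - kappa * p) / Gamma (beta - alpha * p) * p `^ p) => x x0.
have em := ML_moment_entire alpha_gt0 kappa_gt0 b0 g0 Delta_gt0.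
have [_ cv] := cvg_odd_even (egf_sum_cvg_egf (x := x) em).
apply: (ler_cvg_to (cvgMl_tmp cv) (cvg_cst _)).
exists 1%N => // -[//|k] _ /=.
have base (y : R) : 0 < y -> y `^ p * egf_sum (fun=> 1) k.+1.*2 y <= p `^ p.
  move=> y0; apply: le_trans (powR_expR_le p0 y0).
  rewrite ler_wpM2l ?powR_ge0//.
  have := expR_egf_sum k.+1.*2 (ltW y0).
  by rewrite -muln2 exprM sqrr_sign mul1r subr_ge0 muln2.
have := truncated_bound alpha_gt0 kappa_gt0 g0 ak agkb (ltW p0) pg
  (powR_ge0 p p) base x0.
by rewrite (@eq_egf_sum _ _ (M beta gamma))// => n; rewrite mulr1.
Qed.

End ML_family.

Lemma ML_egf (R : realType) (alpha beta gamma kappa : R) :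
  0 < alpha -> 0 < kappa -> 0 < beta -> 0 < gamma ->
  0 < 1 + alpha - kappa ->
  (fun x => ML alpha beta gamma kappa (- x)) =
  (fun x => (Gamma gamma)^-1 * egf (ML_moment alpha beta gamma kappa) x).
Proof.
move=> a0 k0 b0 g0 D0; apply/funext => x.
have em := ML_moment_entire a0 k0 b0 g0 D0.
apply/cvg_lim => //.
rewrite [X in X @ _ --> _](_ : _ = (fun K =>
    (Gamma gamma)^-1 * egf_sum (ML_moment alpha beta gamma kappa) K x)).
  by apply: cvgMl_tmp; exact: egf_sum_cvg_egf.
apply/funext => K; rewrite -egf_sumZ; congr pseries; apply/funext => n.
exact: ML_coefE.
Qed.

(** * Log-convexity of the moments *)

Section log_convexity.
Variable R : realType.
Implicit Types A : nat -> R -> R.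

(** When [A j] is the [j]-th derivative of a function up to the sign
    [(-1)^j], this is its Taylor polynomial at [y] evaluated at [0]. *)
Definition taylor_at0 A (N : nat) (y : R) : R :=
  \sum_(k < N) A k y * y ^+ k / k`!%:R.

Lemma taylor_at0_derive A (N : nat) (y : R) :
  (forall j (x : R), is_derive x 1 (A j) (- A j.+1 x)) ->
  is_derive y 1 (taylor_at0 A N.+1) (- (A N.+1 y * y ^+ N / N`!%:R)).
Proof.
move=> dA; elim: N => [|N IH].
  have -> : taylor_at0 A 1 = A 0%N.
    by apply/funext => x; rewrite /taylor_at0 big_ord1 expr0 fact0 invr1 !mulr1.
  by rewrite expr0 fact0 invr1 !mulr1; exact: dA.
have -> : taylor_at0 A N.+2 =
    taylor_at0 A N.+1 + (N.+1`!%:R)^-1 \*: (A N.+1 * (@GRing.exp R)^~ N.+1).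
  apply/funext => x; rewrite /taylor_at0 big_ord_recr/=.
  by congr (_ + _); rewrite mulrC.
have dX := is_deriveX N.+1 (is_derive_id y (1 : R)).
have -> : (@GRing.exp R)^~ N.+1 = (@id R) ^+ N.+1.
  by apply/funext => x; rewrite exprfctE.
apply: is_derive_eq (is_deriveD IH (is_deriveZ _ (is_deriveM (dA N.+1 y) dX))) _.
rewrite /GRing.scale/= exprfctE factS natrM.
have K0 : N`!%:R != 0 :> R by rewrite pnatr_eq0 -lt0n fact_gt0.
by field; rewrite K0 ?natr1 ?nat1r pnatr_eq0.
Qed.

Lemma alternating_derivatives_le A (j : nat) (y : R) :
  (forall j (x : R), is_derive x 1 (A j) (- A j.+1 x)) ->
  (forall j x, 0 <= x -> 0 <= A j x) -> 0 <= y -> A j y <= A j 0.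
Proof.
move=> dA A0 y0.
apply: (@nonincreasing_is_derive R (A j) (fun x => - A j.+1 x)) => //.
by move=> x /andP[x0 _]; rewrite oppr_le0 A0.
Qed.

(** As a function of the center [y], the Taylor polynomial has derivative
    [- A N+1 y * y^N / N!], which is between [- A N+1 0 * y^N / N!] and [0]. *)
Lemma taylor_at0_cvg A (y : R) :
  (forall j (x : R), is_derive x 1 (A j) (- A j.+1 x)) ->
  (forall j x, 0 <= x -> 0 <= A j x) -> 0 <= y ->
  A N 0 * y ^+ N / N`!%:R @[N --> \oo] --> 0 ->
  taylor_at0 A N.+1 y @[N --> \oo] --> A 0%N 0.
Proof.
move=> dA A0 y0 rem.
have at0 N : taylor_at0 A N.+1 0 = A 0%N 0.
  rewrite /taylor_at0 big_ord_recl/= expr0 fact0 invr1 !mulr1.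
  rewrite big1 ?addr0// => k _.
  by rewrite expr0n mulr0 mul0r.
have pos N (x : R) : 0 <= x -> 0 <= x ^+ N / N`!%:R.
  by move=> x0; rewrite divr_ge0 ?exprn_ge0.
have rem' : A 0%N 0 - A N.+1 0 * y ^+ N.+1 / N.+1`!%:R @[N --> \oo] --> A 0%N 0.
  rewrite -[X in _ --> X]subr0; apply: cvgB; first exact: cvg_cst.
  by rewrite (cvg_shiftS (fun N => A N 0 * y ^+ N / N`!%:R)).
apply: (squeeze_cvgr _ rem' (cvg_cst _)); apply: nearW => N.
apply/andP; split.
  pose g (x : R) := - (taylor_at0 A N.+1 x + A N.+1 0 * x ^+ N.+1 / N.+1`!%:R).
  pose dg (x : R) := - ((A N.+1 0 - A N.+1 x) * (x ^+ N / N`!%:R)).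
  have : g y <= g 0.
    apply: (@nonincreasing_is_derive R g dg 0 y y0) => x /andP[x0 _]; last first.
      rewrite oppr_le0 mulr_ge0 ?pos// subr_ge0.
      exact: alternating_derivatives_le.
    have dX := is_deriveX N.+1 (is_derive_id x (1 : R)).
    have -> : g =
        - (taylor_at0 A N.+1 + (A N.+1 0 / N.+1`!%:R) \*: (@id R) ^+ N.+1).
      by apply/funext => z; rewrite /g mulrAC !fctE.
    apply: is_derive_eq (is_deriveN (is_deriveD (taylor_at0_derive N x dA)
      (is_deriveZ _ dX))) _.
    rewrite /dg /GRing.scale/= factS natrM.
    have K0 : N`!%:R != 0 :> R by rewrite pnatr_eq0 -lt0n fact_gt0.
    by field; rewrite K0 ?natr1 ?nat1r pnatr_eq0.
  by rewrite /g lerN2 at0 expr0n mulr0 mul0r addr0 lerBlDr.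
rewrite -(at0 N).
apply: (@nonincreasing_is_derive R _ _ 0 y y0
  (fun x _ => taylor_at0_derive N x dA)).
by move=> x /andP[x0 _]; rewrite oppr_le0 -mulrA mulr_ge0 ?A0 ?pos.
Qed.

(** Weighting the Taylor sum by [k] amounts to taking the Taylor sum of the next
    derivative. *)
Lemma taylor_at0_weight A (w : nat -> R) (N : nat) (y : R) :
  \sum_(k < N.+1) k%:R * w k * (A k y * y ^+ k / k`!%:R) =
  y * \sum_(k < N) w k.+1 * (A k.+1 y * y ^+ k / k`!%:R).
Proof.
rewrite big_ord_recl/= !mul0r add0r mulr_sumr; apply: eq_bigr => k _.
rewrite /bump leq0n add1n exprS factS natrM.
have K0 : k`!%:R != 0 :> R by rewrite pnatr_eq0 -lt0n fact_gt0.
by field; rewrite K0 ?natr1 ?nat1r pnatr_eq0.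
Qed.

(** The numbers [A k y * y^k / k!] are the weights of a positive measure on the
    points [k / y], and for large [y] its moments of orders [0], [1] and [2]
    approach [A 0 0], [A 1 0] and [A 2 0]. Hence
    [l^2 A 0 0 - 2 l A 1 0 + A 2 0], the limit of the integrals of
    [(l - t)^2], is nonnegative for all [l]. *)
Lemma alternating_derivatives_log_convex A :
  (forall j (x : R), is_derive x 1 (A j) (- A j.+1 x)) ->
  (forall j x, 0 <= x -> 0 <= A j x) ->
  (forall j (y : R), 0 < y ->
    A (j + N)%N 0 * y ^+ N / N`!%:R @[N --> \oo] --> 0) ->
  0 < A 0%N 0 ->
  A 1%N 0 ^+ 2 <= A 0%N 0 * A 2 0.
Proof.
move=> dA A0 rem A00.
set m0 := A 0%N 0; set m1 := A 1%N 0; set m2 := A 2 0.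
pose A1 j := A j.+1; pose A2 j := A j.+2.
have ineq (l y : R) : 0 < y -> 0 <= l ^+ 2 * m0 - 2 * l * m1 + m2 + m1 * y^-1.
  move=> y0.
  have c0 : taylor_at0 A N.+3 y @[N --> \oo] --> m0.
    have := taylor_at0_cvg dA A0 (ltW y0) (rem 0%N y y0).
    by rewrite -cvg_shiftS -cvg_shiftS.
  have c1 : taylor_at0 A1 N.+2 y @[N --> \oo] --> m1.
    rewrite (cvg_shiftS (fun N => taylor_at0 A1 N.+1 y)).
    apply: taylor_at0_cvg => //.
    - by move=> j x; exact: A0.
    - exact: ltW.
    - exact: rem 1%N y y0.
  have c2 : taylor_at0 A2 N.+1 y @[N --> \oo] --> m2.
    apply: taylor_at0_cvg => //.
    - by move=> j x; exact: A0.
    - exact: ltW.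
    - exact: rem 2%N y y0.
  have cl : l ^+ 2 * taylor_at0 A N.+3 y - 2 * l * taylor_at0 A1 N.+2 y +
      taylor_at0 A2 N.+1 y + taylor_at0 A1 N.+2 y * y^-1 @[N --> \oo] -->
      l ^+ 2 * m0 - 2 * l * m1 + m2 + m1 * y^-1.
    apply: cvgD; last exact: cvgMr_tmp.
    by apply: cvgD => //; apply: cvgB; exact: cvgMl_tmp.
  apply: (ler_cvg_to (cvg_cst 0) cl); apply: nearW => N.
  (* The integral of [(l y - k)^2]; since [k^2 = k (k - 1) + k], it exceeds the
     expected quadratic form by the term in [y^-1], which is why [y] is sent to
     infinity afterwards. *)
  have sq : 0 <= \sum_(k < N.+3) (l * y - k%:R) ^+ 2 * (A k y * y ^+ k / k`!%:R).
    apply: sumr_ge0 => k _; rewrite mulr_ge0 ?sqr_ge0// mulr_ge0 ?invr_ge0//.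
    by rewrite mulr_ge0 ?A0 ?exprn_ge0// ltW.
  have e1 : \sum_(k < N.+3) k%:R * 1 * (A k y * y ^+ k / k`!%:R) =
      y * taylor_at0 A1 N.+2 y.
    rewrite (taylor_at0_weight A (fun=> 1)); congr (_ * _).
    by apply: eq_bigr => k _; rewrite mul1r.
  have e2 : \sum_(k < N.+3) k%:R * (k%:R - 1) * (A k y * y ^+ k / k`!%:R) =
      y * (y * taylor_at0 A2 N.+1 y).
    rewrite (taylor_at0_weight A (fun k => k%:R - 1)); congr (_ * _).
    under eq_bigr do rewrite -natr1 addrK -[X in X * _]mulr1.
    rewrite (taylor_at0_weight A1 (fun=> 1)); congr (_ * _).
    by apply: eq_bigr => k _; rewrite mul1r.
  have sqE : \sum_(k < N.+3) (l * y - k%:R) ^+ 2 * (A k y * y ^+ k / k`!%:R) =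
      y ^+ 2 * (l ^+ 2 * taylor_at0 A N.+3 y - 2 * l * taylor_at0 A1 N.+2 y +
        taylor_at0 A2 N.+1 y + taylor_at0 A1 N.+2 y * y^-1).
    transitivity ((l * y) ^+ 2 * taylor_at0 A N.+3 y -
        2 * l * y * (y * taylor_at0 A1 N.+2 y) +
        y * (y * taylor_at0 A2 N.+1 y) + y * taylor_at0 A1 N.+2 y).
      rewrite -e1 -e2 /taylor_at0 !mulr_sumr -sumrB -!big_split/=.
      by apply: eq_bigr => k _; ring.
    by field; rewrite gt_eqF.
  by move: sq; rewrite sqE pmulr_rge0// exprn_gt0.
have quad (l : R) : 0 <= l ^+ 2 * m0 - 2 * l * m1 + m2.
  have c : l ^+ 2 * m0 - 2 * l * m1 + m2 + m1 * n.+1%:R^-1 @[n --> \oo] -->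
      l ^+ 2 * m0 - 2 * l * m1 + m2.
    rewrite -[X in _ --> X]addr0; apply: cvgD; first exact: cvg_cst.
    by rewrite -[X in _ --> X](mulr0 m1); apply: cvgMl_tmp; exact: cvg_harmonic.
  by apply: (ler_cvg_to (cvg_cst 0) c); apply: nearW => n; exact: ineq.
rewrite -subr_ge0.
rewrite (_ : _ - _ = m0 * ((m1 / m0) ^+ 2 * m0 - 2 * (m1 / m0) * m1 + m2)).
  by rewrite mulr_ge0 ?quad// ltW.
by field; rewrite gt_eqF.
Qed.

End log_convexity.

(** * Necessity of the two conditions *)

Section necessity.
Variables (R : realType) (alpha kappa : R).
Hypotheses (alpha_gt0 : 0 < alpha) (kappa_gt0 : 0 < kappa).
Hypothesis Delta_gt0 : 0 < 1 + alpha - kappa.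
Local Notation M beta gamma := (ML_moment alpha beta gamma kappa).
Local Notation E beta gamma := (egf (M beta gamma)).

Lemma ML_moment_log_convex (beta gamma : R) :
  0 < beta -> 0 < gamma ->
  (forall n x, 0 < x -> 0 <= E (beta + alpha *+ n) (gamma + kappa *+ n) x) ->
  M beta gamma 1 ^+ 2 <= M beta gamma 0 * M beta gamma 2.
Proof.
move=> b0 g0 cm.
have bj j : 0 < beta + alpha *+ j by rewrite ltr_wpDr// mulrn_wge0// ltW.
have gj j : 0 < gamma + kappa *+ j by rewrite ltr_wpDr// mulrn_wge0// ltW.
pose A j := E (beta + alpha *+ j) (gamma + kappa *+ j).
have A0E j : A j 0 = M beta gamma j.
  by rewrite /A egf_at0 ML_moment_shiftn addn0.
have dA j (x : R) : is_derive x 1 (A j) (- A j.+1 x).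
  have := ML_egf_derive alpha_gt0 kappa_gt0 Delta_gt0 x (bj j) (gj j).
  by rewrite /A !mulrSr !addrA.
have A_ge0 j x : 0 <= x -> 0 <= A j x.
  rewrite le_eqVlt => /predU1P[<-|]; last exact: cm.
  by rewrite A0E ltW// ML_moment_gt0.
have rem j (y : R) : 0 < y ->
    A (j + N)%N 0 * y ^+ N / N`!%:R @[N --> \oo] --> 0.
  move=> y0.
  have em : entire_egf (M (beta + alpha *+ j) (gamma + kappa *+ j)).
    exact: ML_moment_entire.
  have := em (- y); rewrite /egf_sum opprK => /cvg_series_cvg_0.
  set u := (X in X @ _ --> _ -> _).
  suff -> : (fun N => A (j + N)%N 0 * y ^+ N / N`!%:R) = u.
    by [].
  by apply/funext => N; rewrite A0E /u /= ML_moment_shiftn mulrAC.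
have A00 : 0 < A 0%N 0 by rewrite A0E ML_moment_gt0.
have := alternating_derivatives_log_convex dA A_ge0 rem A00.
by rewrite !A0E.
Qed.

(** By log-convexity the quotients of consecutive moments are bounded below by
    the first one, while they are [O(n^(kappa - alpha))]. *)
Lemma ML_necessary_order (beta gamma : R) :
  0 < beta -> 0 < gamma ->
  (forall n x, 0 < x -> 0 <= E (beta + alpha *+ n) (gamma + kappa *+ n) x) ->
  alpha <= kappa.
Proof.
move=> b0 g0 cm; rewrite leNgt; apply/negP => ka.
have m0 n := ML_moment_gt0 alpha_gt0 kappa_gt0 n b0 g0.
have lc n : M beta gamma n.+1 ^+ 2 <= M beta gamma n * M beta gamma n.+2.
  have bn : 0 < beta + alpha *+ n by rewrite ltr_wpDr// mulrn_wge0// ltW.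
  have gn : 0 < gamma + kappa *+ n by rewrite ltr_wpDr// mulrn_wge0// ltW.
  have := ML_moment_log_convex bn gn.
  rewrite !ML_moment_shiftn addn0 addn1 addn2; apply=> k x x0.
  by rewrite -!addrA -!mulrnDr; exact: cm.
pose r := M beta gamma 1 / M beta gamma 0.
have r0 : 0 < r by rewrite divr_gt0.
have rn n : r * M beta gamma n <= M beta gamma n.+1.
  elim: n => [|n IH]; first by rewrite /r divfK// gt_eqF.
  rewrite -(ler_pM2l (m0 n)); apply: le_trans (lc n).
  by rewrite mulrCA mulrA expr2 ler_wpM2r// ltW.
have [C C0 hC] := ML_moment_ratio alpha_gt0 kappa_gt0 b0 g0.
have c0 : C * n%:R `^ (- (alpha - kappa)) @[n --> \oo] --> (0 : R).
  rewrite -[X in _ --> X](mulr0 C); apply: cvgMl_tmp; apply: powRN_cvg0.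
  by rewrite subr_gt0.
have : r <= 0.
  apply: (ler_cvg_to (cvg_cst r) c0); apply: filterS hC => n.
  move=> /(le_trans (rn n)); rewrite ler_pM2r// opprB; exact.
by rewrite leNgt r0.
Qed.

(** The function with parameter [beta + 1] solves the Euler equation whose
    right-hand side is the function with parameter [beta]. *)
Lemma ML_egf_succ_ge0 (beta gamma : R) :
  0 < beta -> 0 < gamma ->
  (forall x, 0 < x -> 0 <= E beta gamma x) ->
  forall x, 0 < x -> 0 <= E (beta + 1) gamma x.
Proof.
move=> b0 g0 E0 x x0.
have b1 : 0 < beta + 1 by rewrite addr_gt0.
have ba : 0 < beta / alpha by rewrite divr_gt0.
pose h y := - E (beta + 1) gamma y.
pose dh y := E (beta + 1 + alpha) (gamma + kappa) y.
have dhE (y : R) : is_derive y 1 h (dh y).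
  have d := ML_egf_derive alpha_gt0 kappa_gt0 Delta_gt0 y b1 g0.
  by apply: is_derive_eq (is_deriveN d) _; rewrite opprK.
have := @euler_ode_decay R h dh (fun y => - (alpha^-1 * E beta gamma y))
  (beta / alpha) 0 0 (lexx 0) ba (lexx 0) dhE.
rewrite mul0r => key.
have : x `^ 0 * h x <= 0.
  apply: key => // y y0.
    rewrite -(ML_egf_euler alpha_gt0 kappa_gt0 Delta_gt0 y b0 g0).
    by rewrite /h /dh !mulrN opprD opprK.
  by rewrite powRr0 mul1r oppr_le0 mulr_ge0 ?E0// invr_ge0 ltW.
by rewrite powRr0 mul1r oppr_le0.
Qed.

Lemma ML_egf_addn_ge0 (beta gamma : R) (j : nat) :
  0 < beta -> 0 < gamma ->
  (forall x, 0 < x -> 0 <= E beta gamma x) ->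
  forall x, 0 < x -> 0 <= E (beta + j%:R) gamma x.
Proof.
move=> b0 g0 E0; elim: j => [|j IH]; first by rewrite addr0.
rewrite -natr1 addrA; apply: ML_egf_succ_ge0 => //.
by rewrite ltr_wpDr.
Qed.

(** In the Euler equation the derivative of the function with parameter
    [beta + 1] is nonpositive. *)
Lemma ML_egf_le_succ (beta gamma x : R) :
  0 < beta -> 0 < gamma ->
  (forall x, 0 < x -> 0 <= E (beta + alpha) (gamma + kappa) x) ->
  0 < x -> E beta gamma x <= beta * E (beta + 1) gamma x.
Proof.
move=> b0 g0 E0 x0.
have ba0 : 0 < beta + alpha by rewrite addr_gt0.
have gk0 : 0 < gamma + kappa by rewrite addr_gt0.
have := ML_egf_euler alpha_gt0 kappa_gt0 Delta_gt0 x b0 g0.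
move/(congr1 (fun t => alpha * t)).
rewrite mulVKf ?gt_eqF// => <-.
have := ML_egf_succ_ge0 ba0 gk0 E0 x0.
rewrite addrAC => h.
rewrite mulrDr [alpha * (beta / _ * _)]mulrA [alpha * (beta / alpha)]mulrCA.
rewrite mulfV ?gt_eqF// mulr1 gerDr pmulr_rle0// mulrN oppr_le0.
by rewrite mulr_ge0// ltW.
Qed.

(** Otherwise choose [p] with [beta / alpha < p < gamma / kappa]. The function
    with parameter [beta + 1] is bounded by a multiple of one with a large
    first parameter, hence is [O(x^-p)], but [x^(beta / alpha)] times it is
    nondecreasing and positive. *)
Lemma ML_necessary_pole (beta gamma : R) :
  0 < beta -> 0 < gamma -> alpha <= kappa ->
  (forall x, 0 < x -> 0 <= E beta gamma x) ->
  (forall x, 0 < x -> 0 <= E (beta + alpha) (gamma + kappa) x) ->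
  alpha * gamma <= kappa * beta.
Proof.
move=> b0 g0 ak E0 E1; rewrite leNgt; apply/negP => lt_pole.
have ba0 : 0 < beta + alpha by rewrite addr_gt0.
have gk0 : 0 < gamma + kappa by rewrite addr_gt0.
have b1 : 0 < beta + 1 by rewrite addr_gt0.
pose b := beta / alpha.
pose p := (b + gamma / kappa) / 2.
have bg : b < gamma / kappa.
  by rewrite /b ltr_pdivrMr// mulrAC ltr_pdivlMr// mulrC [gamma * _]mulrC.
have bp : b < p by rewrite /p; lra.
have pg : kappa * p < gamma.
  by rewrite mulrC -ltr_pdivlMr// /p; lra.
have b00 : 0 < b by rewrite divr_gt0.
have p0 : 0 < p by exact: lt_trans bp.
(* From [beta + 1 + J] on, the sufficient conditions hold. *)
have [J] : exists J : nat, alpha * gamma <= kappa * (beta + 1 + J%:R).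
  exists (Num.truncn (alpha * gamma / kappa)).+1.
  rewrite [kappa * _]mulrC -ler_pdivrMr//; apply: (le_trans (ltW (truncnS_gt _))).
  by rewrite lerDr ltW.
move=> J_large.
have [C1 C10 leJ] : exists2 C, 0 <= C & forall x, 0 < x ->
    E (beta + 1) gamma x <= C * E (beta + 1 + J%:R) gamma x.
  elim: (J) => [|k [C C0 IH]].
    by exists 1 => // x _; rewrite addr0 mul1r.
  have bk : 0 < beta + 1 + k%:R by rewrite ltr_wpDr.
  exists (C * (beta + 1 + k%:R)) => [|x x0]; first by rewrite mulr_ge0// ltW.
  apply: le_trans (IH x x0) _; rewrite -mulrA ler_wpM2l//.
  have Ek y : 0 < y -> 0 <= E (beta + 1 + k%:R + alpha) (gamma + kappa) y.
    move=> y0; have := ML_egf_addn_ge0 k.+1 ba0 gk0 E1 y0.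
    rewrite (_ : beta + alpha + k.+1%:R = beta + 1 + k%:R + alpha)//.
    by rewrite -natr1; ring.
  rewrite (_ : beta + 1 + k.+1%:R = beta + 1 + k%:R + 1); last first.
    by rewrite -natr1 addrA.
  exact: ML_egf_le_succ.
have bJ : 0 < beta + 1 + J%:R by rewrite ltr_wpDr.
have [C2 decay] :=
  ML_egf_decay alpha_gt0 kappa_gt0 Delta_gt0 bJ g0 ak J_large p0 pg.
pose h := E (beta + 1) gamma.
have [x0 x00 hx0] : exists2 x, 0 < x & 0 < h x.
  have h00 : 0 < h 0 by rewrite /h egf_at0 ML_moment_gt0.
  have dh := ML_egf_derive alpha_gt0 kappa_gt0 Delta_gt0 0 b1 g0.
  have h0 : h t @[t --> (0 : R)^'+] --> h 0.
    by apply/cvg_at_right_filter; exact: derive_continuous dh.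
  have hgt := cvgr_gt _ h0 _ h00.
  near (0 : R)^'+ => x.
  by exists x; near: x; [exact: nbhs_right_gt|exact: hgt].
pose phi x := x `^ b * h x.
have phi_incr x : x0 <= x -> phi x0 <= phi x.
  move=> x0x; rewrite -lerN2.
  pose dphi t := - (t `^ (b - 1) * (alpha^-1 * E beta gamma t)).
  apply: (@nonincreasing_is_derive R (fun t => - phi t) dphi x0 x x0x)
    => t /andP[x0t _];
      have t0 : 0 < t by exact: lt_le_trans x0t.
    have dh := ML_egf_derive alpha_gt0 kappa_gt0 Delta_gt0 t b1 g0.
    have dp := is_derive1_powR b t0.
    apply: is_derive_eq (is_deriveN (is_deriveM dp dh)) _.
    rewrite /dphi -(ML_egf_euler alpha_gt0 kappa_gt0 Delta_gt0 t b0 g0) -/b.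
    have -> : t `^ b = t `^ (b - 1) * t by rewrite mulrC mulr_powRB1// ltW.
    rewrite /GRing.scale/=; move: (egf _ t) (egf _ t) (t `^ (b - 1)) => u v w.
    by ring.
  by rewrite oppr_le0 !mulr_ge0 ?powR_ge0 ?E0// invr_ge0 ltW.
have phi_small x : 0 < x -> phi x <= C1 * C2 * x `^ (- (p - b)).
  move=> xp; rewrite /phi.
  have -> : x `^ b = x `^ (- (p - b)) * x `^ p.
    rewrite -powRD; last by rewrite (gt_eqF xp) implybT.
    by congr powR; ring.
  rewrite -mulrA [leRHS]mulrC ler_wpM2l ?powR_ge0//.
  apply: (@le_trans _ _ (C1 * (x `^ p * E (beta + 1 + J%:R) gamma x))).
    by rewrite mulrCA ler_wpM2l ?powR_ge0// leJ.
  by rewrite ler_wpM2l// decay.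
have c0 : C1 * C2 * n%:R `^ (- (p - b)) @[n --> \oo] --> (0 : R).
  rewrite -[X in _ --> X](mulr0 (C1 * C2)); apply: cvgMl_tmp; apply: powRN_cvg0.
  by rewrite subr_gt0.
have : phi x0 <= 0.
  apply: (ler_cvg_to (cvg_cst _) c0); near=> n.
  have xn : x0 <= n%:R by near: n; exact: nbhs_infty_ger.
  by apply: le_trans (phi_incr _ xn) (phi_small _ _); exact: lt_le_trans xn.
by rewrite leNgt mulr_gt0// powR_gt0.
Unshelve. all: by end_near. Qed.
End necessity.

Local Close Scope classical_set_scope.
Unset Implicit Arguments.

Theorem theorem1 (R : realType) (alpha beta gamma kappa : R)
  (alpha_gt0 : 0 < alpha) (beta_gt0 : 0 < beta)
  (gamma_gt0 : 0 < gamma) (kappa_gt0 : 0 < kappa)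
  (Delta_gt0 : 0 < 1 + alpha - kappa) :
  completely_monotone (fun x : R => ML alpha beta gamma kappa (- x)) <->
  (alpha <= kappa /\ kappa * beta >= alpha * gamma).
Proof.
have Gi0 : 0 < (Gamma gamma)^-1 by rewrite invr_gt0 Gamma_gt0.
rewrite ML_egf// completely_monotone_ML_egf//.
split=> [E_ge0|[ak agkb] n x x0].
  have ak := ML_necessary_order alpha_gt0 kappa_gt0 Delta_gt0
    beta_gt0 gamma_gt0 E_ge0.
  split=> //; apply: (ML_necessary_pole alpha_gt0 kappa_gt0 Delta_gt0) => // x x0.
    by have := E_ge0 0%N x x0; rewrite !mulr0n !addr0.
  by have := E_ge0 1%N x x0; rewrite !mulr1n.
apply: (ML_egf_ge0 alpha_gt0 kappa_gt0 Delta_gt0) => //.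
- by rewrite ltr_wpDr// mulrn_wge0// ltW.
- by rewrite ltr_wpDr// mulrn_wge0// ltW.
- by rewrite !mulrDr !mulrnAr [kappa * alpha]mulrC lerD2r.
Qed.
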